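(* There exists a polynomial-time algorithm that, given a hypergraph $\mathcal{H}=(R,\mathcal{E})$ with hyperedge costs $\{c(A):A\in\mathcal{E}\}$ and a spanning tree $T^*$ of $\mathcal{H}$ consisting of hyperedges of size $2$, computes a connected spanning sub-hypergraph $\mathcal{T}$ of $\mathcal{H}$ of cost at most $\tau\left(1+\ln\frac{c(T^* )}{\tau}\right)$, where $\tau$ is the minimum cost of a connected spanning sub-hypergraph of $\mathcal{H}$.
   Context: A sub-hypergraph $(R,\mathcal{E}')$, $\mathcal{E}'\subseteq\mathcal{E}$, is connected spanning if any two nodes of $R$ are connected via a sequence of hyperedges in $\mathcal{E}'$; its cost is $\sum_{A\in\mathcal{E}'}c(A)$. Costs are nonnegative. *)

(* Defs.v *)
From HB Require Import structures.
From mathcomp Require Import all_boot all_order all_algebra.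
From mathcomp Require Import reals exp.

Set Implicit Arguments.
Unset Strict Implicit.
Unset Printing Implicit Defensive.
Import Order.TTheory GRing.Theory Num.Theory.

Local Open Scope nat_scope.

(* Model of computation: a random access machine on natural numbers with the
   logarithmic cost criterion (every operation is charged the bit lengths of
   its operands, addresses included), programmed by structured commands.  It
   simulates, and is simulated by, Turing machines with polynomial overhead.
   The memory is a family of zero-initialised arrays; array names are
   constants of the program, so a program uses finitely many of them, and cell
   0 of an array can serve as a scalar variable. *)

Definition bitlen (x : nat) : nat := (trunc_log 2 x).+1.

Definition memory := nat -> nat -> nat.

Definition update (s : memory) (a i v : nat) : memory :=
  fun b j => if (b == a) && (j == i) then v else s b j.

(* Subtraction is truncated at 0. *)
Inductive expr : Type :=
| Const of nat
| Get of nat & expr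
| Add of expr & expr
| Sub of expr & expr
| Mul of expr & expr.

Fixpoint eval (s : memory) (e : expr) : nat :=
  match e with
  | Const k => k
  | Get a e1 => s a (eval s e1)
  | Add e1 e2 => eval s e1 + eval s e2
  | Sub e1 e2 => eval s e1 - eval s e2
  | Mul e1 e2 => eval s e1 * eval s e2
  end.

Fixpoint eval_cost (s : memory) (e : expr) : nat :=
  match e with
  | Const k => bitlen k
  | Get a e1 =>
      eval_cost s e1 + bitlen (eval s e1) + bitlen (s a (eval s e1))
  | Add e1 e2 | Sub e1 e2 | Mul e1 e2 =>
      eval_cost s e1 + eval_cost s e2 + bitlen (eval s e1) + bitlen (eval s e2)
  end.

(* [Put a i e] is the assignment a[i] := e; tests succeed on nonzero values. *)
Inductive command : Type :=
| Skip
| Put of nat & expr & expr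
| Seq of command & command
| If of expr & command & command
| While of expr & command.

(* [exec p s t s']: started in memory s, p halts in memory s' after time t. *)
Inductive exec : command -> memory -> nat -> memory -> Prop :=
| ExecSkip s : exec Skip s 1 s
| ExecPut s a i e :
    exec (Put a i e) s
      (eval_cost s i + eval_cost s e + bitlen (eval s i) + bitlen (eval s e))
      (update s a (eval s i) (eval s e))
| ExecSeq p1 p2 s1 s2 s3 t1 t2 :
    exec p1 s1 t1 s2 -> exec p2 s2 t2 s3 -> exec (Seq p1 p2) s1 (t1 + t2) s3
| ExecIfTrue e p1 p2 s s' t :
    eval s e != 0 -> exec p1 s t s' ->
    exec (If e p1 p2) s (eval_cost s e + t) s'
| ExecIfFalse e p1 p2 s s' t :
    eval s e = 0 -> exec p2 s t s' ->
    exec (If e p1 p2) s (eval_cost s e + t) s'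
| ExecWhileTrue e p s1 s2 s3 t1 t2 :
    eval s1 e != 0 -> exec p s1 t1 s2 -> exec (While e p) s2 t2 s3 ->
    exec (While e p) s1 (eval_cost s1 e + t1 + t2) s3
| ExecWhileFalse e p s :
    eval s e = 0 -> exec (While e p) s (eval_cost s e) s.

(* Words are stored preceded by their length: the input in array 0, all other
   cells being 0, and the output in array 1. *)
Definition input_memory (w : seq nat) : memory :=
  fun a i => if a == 0 then nth 0 (size w :: w) i else 0.

Definition output (s : memory) : seq nat :=
  mkseq (fun i => s 1 i.+1) (s 1 0).

Definition computes_within
    (p : command) (w : seq nat) (bound : nat) (w' : seq nat) : Prop :=
  exists (t : nat) (s : memory),
    [/\ exec p (input_memory w) t s, t <= bound & output s = w'].

Definition word_size (w : seq nat) : nat := \sum_(x <- w) bitlen x.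

Section Hypergraphs.

Variable n : nat.
Implicit Types (E F : {set {set 'I_n}}) (c : {set 'I_n} -> rat).

Definition coincident F : rel 'I_n :=
  fun u v => [exists A in F, (u \in A) && (v \in A)].

Definition connected_spanning F : bool :=
  [forall u, forall v, connect (coincident F) u v].

Definition cost c F : rat := (\sum_(A in F) c A)%R.

(* A spanning tree, in the sense of graphs, made of hyperedges of size 2. *)
Definition acyclic F : Prop :=
  forall s : seq 'I_n, uniq s -> 2 < size s -> ~~ cycle (coincident F) s.

Definition spanning_tree2 E F : Prop :=
  [/\ F \subset E, {in F, forall A : {set 'I_n}, #|A| = 2},
      connected_spanning F & acyclic F].

(* Meaningful when E itself is connected spanning. *)
Definition min_cost E c : rat :=
  cost c [arg min_(F < E | (F \subset E) && connected_spanning F) cost c F]%O.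

(* The hyperedges are listed by es in an arbitrary order; each is given by its
   incidence vector, the numerator and the denominator of its (nonnegative)
   cost, and a bit telling whether it belongs to the tree. *)
Definition encode_hyperedge c F (A : {set 'I_n}) : seq nat :=
  [seq nat_of_bool (v \in A) | v <- enum 'I_n]
    ++ [:: `|numq (c A)|%N; `|denq (c A)|%N; nat_of_bool (A \in F)].

Definition encode_instance (es : seq {set 'I_n}) c F : seq nat :=
  [:: n, size es & flatten [seq encode_hyperedge c F A | A <- es]].

Definition encode_subset (es : seq {set 'I_n}) F : seq nat :=
  [seq nat_of_bool (A \in F) | A <- es].

End Hypergraphs.

(* Main.v *)
Require Import Defs.
From HB Require Import structures.
From mathcomp Require Import all_boot all_order all_algebra.
From mathcomp Require Import reals exp.
From mathcomp Require Import zify ring lra.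
Import Order.TTheory GRing.Theory Num.Theory.

(* The algorithm keeps a set C of chosen hyperedges.  Let mst(C) be the least
   weight of a part of T* that connects everything together with C, as found by
   Kruskal's algorithm, and let drop(A) = mst(C) - mst(C + A).  Each round adds
   the hyperedge A with the largest ratio drop(A) / c(A), as long as this ratio
   exceeds 1; the output is C together with its Kruskal completion.

   Connectivity is read off ranks: with a hyperedge A one associates the span of
   the vectors e_u - e_v, u, v in A.  Submodularity of dimension gives
   mst(C) <= sum of drop(B) over the hyperedges B of an optimal solution, so the
   chosen A satisfies c(A) mst(C) <= tau drop(A), and mst(C) <= tau at the end.
   Hence the cost of C plus f(mst(C)) never increases, where f(x) = x for
   x <= tau and f(x) = tau (1 + ln (x / tau)) otherwise, which is the bound.

   For the running time, loop counts are words of the input and every stored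
   value exceeds the previous ones by boundedly many factors taken from the
   input, so bit lengths grow linearly in the number of steps. *)

Local Open Scope nat_scope.

(** * A language of bounded loops that runs in polynomial time *)

(* [For x k p] runs p with counter cell x[0] = 0, 1, ..., N - 1, where N is
   the input cell 0[k]; after the loop the counter holds N. *)
Inductive prog : Type :=
| Nop
| Assign of nat & expr & expr
| Then of prog & prog
| Cond of expr & prog & prog
| For of nat & nat & prog.

Definition incr (x : nat) : command :=
  Put x (Const 0) (Add (Get x (Const 0)) (Const 1)).

Definition below (x k : nat) : expr :=
  Defs.Sub (Get 0 (Const k)) (Get x (Const 0)).

Fixpoint compile (p : prog) : command :=
  match p with
  | Nop => Skip
  | Assign a i e => Put a i e
  | Then p1 p2 => Seq (compile p1) (compile p2)
  | Cond e p1 p2 => If e (compile p1) (compile p2)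
  | For x k p1 =>
      Seq (Put x (Const 0) (Const 0))
          (While (below x k) (Seq (compile p1) (incr x)))
  end.

(** A total semantics: loop counts are fixed at entry, whereas the compiled loop rereads its bound
    and counter at every test. For [wf] programs the two agree, since the body writes neither array
    0 nor the counter. *)
Fixpoint run (p : prog) (s : memory) : memory :=
  match p with
  | Nop => s
  | Assign a i e => update s a (eval s i) (eval s e)
  | Then p1 p2 => run p2 (run p1 s)
  | Cond e p1 p2 => if eval s e != 0 then run p1 s else run p2 s
  | For x k p1 =>
      iter (s 0 k)
        (fun s1 => let s2 := run p1 s1 in update s2 x 0 (s2 x 0 + 1))
        (update s x 0 0)
  end.

Fixpoint writes (p : prog) : seq nat :=
  match p with
  | Nop => [::]
  | Assign a _ _ => [:: a]
  | Then p1 p2 | Cond _ p1 p2 => writes p1 ++ writes p2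
  | For x _ p1 => x :: writes p1
  end.

(* The bit length of such an expression exceeds that of the memory contents
   by at most a multiple of the bit length of the input. *)
Fixpoint lin_expr (e : expr) : bool :=
  match e with
  | Const _ | Get _ _ => true
  | Add e1 e2 | Defs.Sub e1 e2 => lin_expr e1 && lin_expr e2
  | Mul e1 (Get 0 _) => lin_expr e1
  | Mul _ _ => false
  end.

(* Loop counts are restricted to the first two words of the input. *)
Fixpoint wf (p : prog) : bool :=
  match p with
  | Nop => true
  | Assign a _ e => (a != 0) && lin_expr e
  | Then p1 p2 | Cond _ p1 p2 => wf p1 && wf p2
  | For x k p1 => [&& x != 0, k \in [:: 1; 2], x \notin writes p1 & wf p1]
  end.

Lemma bitlen_le x y : x <= y -> bitlen x <= bitlen y.
Proof. by move=> le_xy; rewrite ltnS leq_trunc_log. Qed.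

Lemma bitlen_lt x k : x < 2 ^ k.+1 -> bitlen x <= k.+1.
Proof.
move=> lt_x; rewrite ltnS; case: x lt_x => [|x] lt_x; first by rewrite trunc_log0.
by rewrite -ltnS -(ltn_exp2l _ _ (isT : 1 < 2)) (leq_ltn_trans (trunc_logP _ _)).
Qed.

Lemma lt_bitlen x : x < 2 ^ bitlen x.
Proof. exact: trunc_log_ltn. Qed.

Lemma bitlenD x y : bitlen (x + y) <= (maxn (bitlen x) (bitlen y)).+1.
Proof.
apply: bitlen_lt; rewrite expnS mul2n -addnn.
have lt_pow z b : bitlen z <= b -> z < 2 ^ b.
  by move=> le_b; apply: leq_trans (lt_bitlen z) _; rewrite leq_exp2l.
have /lt_pow lt_x := leq_maxl (bitlen x) (bitlen y).
have /lt_pow lt_y := leq_maxr (bitlen x) (bitlen y).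
lia.
Qed.

Lemma bitlenM x y : bitlen (x * y) <= bitlen x + bitlen y.
Proof.
rewrite {2}/bitlen addSn; apply: bitlen_lt; rewrite -addSn expnD.
exact: ltn_mul (lt_bitlen x) (lt_bitlen y).
Qed.

Definition fits (b : nat) (s : memory) : Prop :=
  forall a i, bitlen (s a i) <= b.

Lemma fitsS b b' s : b <= b' -> fits b s -> fits b' s.
Proof. by move=> le_b fits_s a i; apply: leq_trans le_b. Qed.

Lemma fits_update b s a i v : fits b s -> bitlen v <= b -> fits b (update s a i v).
Proof. by move=> fits_s le_v a' i'; rewrite /update; case: ifP. Qed.

Lemma fits_gt0 b s : fits b s -> 0 < b.
Proof. by move/(_ 0 0); apply: leq_trans. Qed.

(** Every operation at most adds up the bit lengths of its operands, and the expression is fixed, so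
    one constant suffices. Literal constants are absorbed because [b] is positive. *)
Lemma eval_cost_bound e :
  exists K, forall s b, fits b s ->
    eval_cost s e <= K * b /\ bitlen (eval s e) <= K * b.
Proof.
have max2 x y : maxn x y <= x + y by lia.
elim: e => [k|a e [K IH]|e1 [K1 IH1] e2 [K2 IH2]|e1 [K1 IH1] e2 [K2 IH2]
           |e1 [K1 IH1] e2 [K2 IH2]] /=.
- by exists (bitlen k) => s b /fits_gt0 b_gt0; rewrite leq_pmulr.
- exists (K + K + 1) => s b fits_s; have [] := IH s b fits_s.
  by have := fits_s a (eval s e); split; nia.
- exists (K1 + K2 + K1 + K2 + 1) => s b fits_s.
  have [] := IH1 s b fits_s; have [] := IH2 s b fits_s.
  have := bitlenD (eval s e1) (eval s e2).
  by have := max2 (bitlen (eval s e1)) (bitlen (eval s e2));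
     have := fits_gt0 _ _ fits_s; split; nia.
- exists (K1 + K2 + K1 + K2) => s b fits_s.
  have [] := IH1 s b fits_s; have [] := IH2 s b fits_s.
  by have := bitlen_le _ _ (leq_subr (eval s e2) (eval s e1)); split; nia.
- exists (K1 + K2 + K1 + K2) => s b fits_s.
  have [] := IH1 s b fits_s; have [] := IH2 s b fits_s.
  by have := bitlenM (eval s e1) (eval s e2); split; nia.
Qed.

(** The point is that [b] has coefficient 1: growth is additive, so repeating an assignment in a
    loop cannot compound it exponentially. A factor from the input costs at most [g] bits, and
    addresses are unrestricted because any cell read already fits. *)
Lemma lin_expr_growth e : lin_expr e ->
  exists K, forall s b g, 0 < g -> fits b s -> (forall j, bitlen (s 0 j) <= g) ->
    bitlen (eval s e) <= b + K * g.
Proof.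
elim: e => [k _|a e _ _|e1 IH1 e2 IH2 /andP[/IH1[K1 {}IH1] /IH2[K2 {}IH2]]
           |e1 IH1 e2 IH2 /andP[/IH1[K1 {}IH1] _]|e1 IH1 [|[|?] e2|||]] //.
- by exists (bitlen k) => s b g g_gt0 _ _; rewrite /=; nia.
- by exists 0 => s b g _ fits_s _; rewrite mul0n addn0; exact: fits_s.
- exists (K1 + K2 + 1) => s b g g_gt0 fits_s in_g /=.
  have := IH1 s b g g_gt0 fits_s in_g; have := IH2 s b g g_gt0 fits_s in_g.
  have := bitlenD (eval s e1) (eval s e2).
  by rewrite /maxn; case: ifP => _; nia.
- exists K1 => s b g g_gt0 fits_s in_g /=; apply: leq_trans (IH1 s b g g_gt0 fits_s in_g).
  exact/bitlen_le/leq_subr.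
- move=> _ /IH1[K1 {}IH1]; exists (K1 + 1) => s b g g_gt0 fits_s in_g /=.
  have := IH1 s b g g_gt0 fits_s in_g; have := in_g (eval s e2).
  by have := bitlenM (eval s e1) (s 0 (eval s e2)); nia.
Qed.

Lemma update_neq s a i v b j : b != a -> update s a i v b j = s b j.
Proof. by rewrite /update => /negPf->. Qed.

Lemma run_frame p s a j : a \notin writes p -> run p s a j = s a j.
Proof.
elim: p s => [|a' i e|p1 IH1 p2 IH2|e p1 IH1 p2 IH2|x k p IH] s //=.
- by rewrite inE => /update_neq.
- by rewrite mem_cat negb_or => /andP[n1 n2]; rewrite IH2 ?IH1.
- by rewrite mem_cat negb_or => /andP[n1 n2]; case: ifP; rewrite ?IH1 ?IH2.
rewrite inE negb_or => /andP[n_x n_p].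
by elim: (s 0 k) => [|N IHN] /=; rewrite update_neq // IH.
Qed.

Lemma wf_keeps_input p : wf p -> 0 \notin writes p.
Proof.
elim: p => [|a i e|p1 IH1 p2 IH2|e p1 IH1 p2 IH2|x k p IH] //=.
- by rewrite inE eq_sym => /andP[].
- by case/andP=> /IH1 n1 /IH2 n2; rewrite mem_cat negb_or n1.
- by case/andP=> /IH1 n1 /IH2 n2; rewrite mem_cat negb_or n1.
- by case/and4P=> x0 _ _ /IH n_p; rewrite inE negb_or eq_sym x0.
Qed.

(** Cells 1 and 2 are loop counts and are bounded as numbers; the other input cells only in bit
    length. *)
Definition small_input (W : nat) (s : memory) : Prop :=
  [/\ 0 < W, s 0 1 <= W, s 0 2 <= W & forall j, bitlen (s 0 j) <= W].

Lemma small_input_eq W s s' :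
  (forall j, s' 0 j = s 0 j) -> small_input W s -> small_input W s'.
Proof. by move=> eq_s [? ? ? in_W]; split; rewrite ?eq_s // => j; rewrite eq_s. Qed.

(** The memory bound [b] grows only by an additive term depending on [W]. This form is closed under
    sequencing and, with at most [W] iterations, under loops, so nesting loops keeps everything
    polynomial. *)
Lemma compile_poly p : wf p ->
  exists q1 q2 : {poly nat}, forall W s b, small_input W s -> fits b s ->
    exists t, [/\ exec (compile p) s t (run p s),
                  t <= q1.[W]%R * (b + q2.[W]%R) &
                  fits (b + q2.[W]%R) (run p s)].
Proof.
elim: p => [|a i e|p1 IH1 p2 IH2|e p1 IH1 p2 IH2|x k p IH] /=.
- move=> _; exists 1%R, 0%R => W s b _ fits_s; exists 1.
  split; [exact: ExecSkip| |]; rewrite !hornerC addn0 //.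
  by rewrite mul1n (fits_gt0 _ _ fits_s).
- case/andP=> a0 /lin_expr_growth[K growth].
  have [K1 cost1] := eval_cost_bound i; have [K2 cost2] := eval_cost_bound e.
  exists (K1 + K2 + K1 + K2)%:P%R, (K%:P * 'X)%R => W s b in_s fits_s.
  have [W0 _ _ in_W] := in_s.
  rewrite hornerC hornerCM hornerX.
  eexists; split; first exact: ExecPut.
    by have [] := cost1 s b fits_s; have [] := cost2 s b fits_s; nia.
  apply: fits_update; first by apply: fitsS fits_s; exact: leq_addr.
  exact: growth.
- case/andP=> wf1 wf2; have [q1 [g1 {}IH1]] := IH1 wf1.
  have [q2 [g2 {}IH2]] := IH2 wf2.
  exists (q1 + q2)%R, (g1 + g2)%R => W s b in_s fits_s; rewrite !hornerD.
  have [t1 [ex1 le1 fits1]] := IH1 W s b in_s fits_s.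
  have in_s1 : small_input W (run p1 s).
    by apply: small_input_eq in_s => j; rewrite run_frame ?wf_keeps_input.
  have [t2 [ex2 le2 fits2]] := IH2 W _ _ in_s1 fits1.
  exists (t1 + t2); split; first exact: ExecSeq ex1 ex2.
    by move: le1 le2; rewrite !natrDE; nia.
  by rewrite natrDE addnA.
- case/andP=> wf1 wf2; have [q1 [g1 {}IH1]] := IH1 wf1.
  have [q2 [g2 {}IH2]] := IH2 wf2; have [K costE] := eval_cost_bound e.
  exists (K%:P + q1 + q2)%R, (g1 + g2)%R => W s b in_s fits_s.
  rewrite !hornerD hornerC !natrDE.
  have [costs _] := costE s b fits_s.
  case: ifP => [nz|/negbFE/eqP z].
    have [t1 [ex1 le1 fits1]] := IH1 W s b in_s fits_s.
    exists (eval_cost s e + t1); split; first exact: ExecIfTrue.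
      by nia.
    by apply: fitsS fits1; lia.
  have [t2 [ex2 le2 fits2]] := IH2 W s b in_s fits_s.
  exists (eval_cost s e + t2); split; first exact: ExecIfFalse.
    by nia.
  by apply: fitsS fits2; lia.
case/and4P=> x0 k12 x_p wf_p; have [q [g {}IH]] := IH wf_p.
have [K1 cost_test] := eval_cost_bound (below x k).
have [K2 cost_incr] := eval_cost_bound (Add (Get x (Const 0)) (Const 1)).
(* [Q] collects the cost of one test, body and counter update; [G] is the growth in bits of one
   iteration, with one extra bit for the incremented counter. The factor ['X + 2] covers the
   iterations, the final test and the initial reset. *)
pose Q := (K1%:P + K2%:P + K2%:P + 2%:P + q)%R : {poly nat}.
pose G := (g + 1)%R : {poly nat}.
exists (('X + 2%:P) * Q)%R, (('X + 2%:P) * G)%R => W s b in_s fits_s.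
have [W0 in1 in2 _] := in_s.
have le_kW : s 0 k <= W by move: k12; rewrite !inE => /orP[] /eqP->.
have QE : (Q.[W] = (K1 + K2 + K2 + 2 + q.[W])%N)%R by by rewrite !hornerD !hornerC.
have GE : (G.[W] = (g.[W] + 1)%N)%R by rewrite hornerD hornerC.
have XE (r : {poly nat}) : ((('X + 2%:P) * r).[W] = ((W + 2) * r.[W])%N)%R.
  by rewrite hornerM hornerD hornerX hornerC.
rewrite !XE {XE}.
set body := fun s1 : memory => update _ x 0 (_ + 1).
(* Here [j] is the number of iterations still to run. The memory and [b1] are general because each
   iteration raises the bit bound. *)
have loop j : forall s1 b1, small_input W s1 -> fits b1 s1 -> s1 x 0 + j = s1 0 k ->
  exists t, [/\ exec (While (below x k) (Seq (compile p) (incr x))) s1 t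
                  (iter j body s1),
                t <= j.+1 * Q.[W]%R * (b1 + j.+1 * G.[W]%R) &
                fits (b1 + j * G.[W]%R) (iter j body s1)].
  elim: j => [|j IHj] s1 b1 in1' fits1 cnt.
    have [le1 _] := cost_test s1 b1 fits1.
    exists (eval_cost s1 (below x k)); split.
    - by apply: ExecWhileFalse; rewrite /= -cnt addn0 subnn.
    - by rewrite QE GE; nia.
    - by rewrite mul0n addn0.
  have [le1 _] := cost_test s1 b1 fits1.
  have [t2 [ex2 le2 fits2]] := IH W s1 b1 in1' fits1.
  have [le3 _] := cost_incr _ _ fits2.
  have eq0 i : body s1 0 i = s1 0 i.
    by rewrite /body update_neq 1?eq_sym // run_frame ?wf_keeps_input.
  have eqx : body s1 x 0 = (s1 x 0).+1.
    by rewrite /body /update !eqxx /= run_frame // addn1.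
  have in_b : small_input W (body s1) by exact: small_input_eq in1'.
  have fits_x := fits2 x 0.
  have bit_x : bitlen (run p s1 x 0 + 1) <= b1 + G.[W]%R.
    rewrite GE; have := bitlenD (run p s1 x 0) 1; have : bitlen 1 = 1 by [].
    by have := fits_gt0 _ _ fits2; lia.
  have fits_b : fits (b1 + G.[W]%R) (body s1).
    rewrite /body; apply: fits_update => //; apply: fitsS fits2; rewrite GE; lia.
  have cnt' : body s1 x 0 + j = body s1 0 k by rewrite eqx eq0 -cnt addSnnS.
  have [t3 [ex3 le4 fits3]] := IHj _ _ in_b fits_b cnt'.
  have := @ExecPut (run p s1) x (Const 0) (Add (Get x (Const 0)) (Const 1)).
  set ti := (X in exec _ _ X _) => ex_i.
  have le_i : ti <= (K2 + K2 + 2) * (b1 + G.[W]%R).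
    have [_ le5] := cost_incr _ _ fits2.
    have -> : ti = 1 + eval_cost (run p s1) (Add (Get x (Const 0)) (Const 1)) + 1
                 + bitlen (eval (run p s1) (Add (Get x (Const 0)) (Const 1))) by [].
    rewrite GE addnA; have := fits_gt0 _ _ fits2; move: le3 le5.
    by set B := b1 + _ => le3 le5 B_gt0; rewrite mulnDr !mulnDl; lia.
  exists (eval_cost s1 (below x k) + (t2 + ti) + t3); split.
  - rewrite iterSr; apply: ExecWhileTrue ex3.
      by rewrite /= -cnt addKn.
    exact: ExecSeq ex2 ex_i.
  - have e1 : eval_cost s1 (below x k) + (t2 + ti) <= Q.[W]%R * (b1 + G.[W]%R).
      have {}le1 := leq_trans le1 (leq_mul (leqnn K1) (leq_addr G.[W]%R b1)).
      have le_g : b1 + g.[W]%R <= b1 + G.[W]%R by rewrite GE addnA leq_addr.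
      have {}le2 := leq_trans le2 (leq_mul (leqnn _) le_g).
      by move: le1 le2 le_i; rewrite QE; set B := b1 + _; rewrite !mulnDl; lia.
    have e2 : t3 <= j.+1 * Q.[W]%R * (b1 + j.+2 * G.[W]%R).
      by apply: leq_trans le4 _; rewrite -addnA -mulSn.
    have e3 : Q.[W]%R * (b1 + G.[W]%R) <= Q.[W]%R * (b1 + j.+2 * G.[W]%R).
      by rewrite leq_mul // leq_add2l leq_pmull.
    by apply: leq_trans (leq_add (leq_trans e1 e3) e2) _; rewrite -mulnDl -mulSn.
  - rewrite iterSr; have -> : b1 + j.+1 * G.[W]%R = b1 + G.[W]%R + j * G.[W]%R by lia.
    exact: fits3.
have fits0 : fits b (update s x 0 0).
  by apply: fits_update; rewrite // (fits_gt0 _ _ fits_s).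
have eq0 i : update s x 0 0 0 i = s 0 i by rewrite update_neq // eq_sym.
have in0 : small_input W (update s x 0 0) by exact: small_input_eq in_s.
have cnt0 : update s x 0 0 x 0 + s 0 k = update s x 0 0 0 k.
  by rewrite eq0 /update !eqxx.
have [t [ex le_t fits_t]] := loop _ _ _ in0 fits0 cnt0.
have := @ExecPut s x (Const 0) (Const 0); rewrite [eval s _]/=.
set t0 := (X in exec _ _ X _) => ex0.
exists (t0 + t); split; first exact: ExecSeq ex0 ex.
  (* The reset costs four times the bit length of 0, which is 1; the spare unit of [W + 2] pays for
     it. *)
  have -> : t0 = 4 by [].
  have b_gt0 := fits_gt0 _ _ fits_s.
  have : 2 <= Q.[W]%R by rewrite QE; lia.
  have : 1 <= G.[W]%R by rewrite GE; lia.
  move: (Q.[W]%R) (G.[W]%R) le_t => c d le_t d_gt0 c_gt1.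
  have : (s 0 k).+1 * c * (b + (s 0 k).+1 * d) <= W.+1 * c * (b + W.+2 * d).
    by apply: leq_mul; [rewrite leq_mul2r|rewrite leq_add2l leq_mul2r]; lia.
  have -> : (W + 2) * c * (b + (W + 2) * d) =
            W.+1 * c * (b + W.+2 * d) + c * (b + W.+2 * d) by rewrite addn2; lia.
  have : 4 <= c * (b + W.+2 * d) by nia.
  by lia.
by apply: fitsS fits_t; rewrite leq_add2l leq_mul2r; lia.
Qed.

(** * Greedy weights over a family of subspaces *)

Section GreedyWeight.

Variables (K : fieldType) (vT : vectType K) (I : eqType) (V : I -> {vspace vT}).

Definition join (s : seq I) : {vspace vT} := (\sum_(i <- s) V i)%VS.

(** The greedy algorithm of a linear matroid contracted by [U]: an element is paid for when it is
    independent of [U] and everything before it. *)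
Fixpoint greedy_weight (wt : I -> nat) (U : {vspace vT}) (s : seq I) : nat :=
  if s is e :: s' then
    (if (V e <= U)%VS then 0 else wt e) + greedy_weight wt (U + V e) s'
  else 0.

Lemma addvCA (U1 U2 U3 : {vspace vT}) : (U1 + (U2 + U3) = U2 + (U1 + U3))%VS.
Proof. by rewrite !addvA (addvC U1). Qed.

Lemma addvAC (U1 U2 U3 : {vspace vT}) : (U1 + U2 + U3 = U1 + U3 + U2)%VS.
Proof. by rewrite -!addvA (addvC U2). Qed.

(** Grassmann's identity for [U + W1] and [U + W2], whose intersection contains [U]. *)
Lemma dim_submodular (U W1 W2 : {vspace vT}) :
  \dim (U + W1 + W2) + \dim U <= \dim (U + W1) + \dim (U + W2).
Proof.
have -> : (U + W1 + W2 = (U + W1) + (U + W2))%VS.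
  by rewrite -[RHS]addvA (addvCA W1) addvA addvv addvA.
by rewrite -(dimv_sum_cap (U + W1) (U + W2)) leq_add2l dimvS // subv_cap !addvSl.
Qed.

(** Submodularity iterated: the single increments add up to at least the joint one. The terms are
    arranged so that no truncated subtraction occurs. *)
Lemma dim_sum_increments (J : Type) (r : seq J) (U : {vspace vT})
    (W : J -> {vspace vT}) :
  \dim (U + \sum_(j <- r) W j) + size r * \dim U <=
  \dim U + \sum_(j <- r) \dim (U + W j).
Proof.
elim: r => [|j r IH]; first by rewrite !big_nil addv0 mul0n !addn0.
rewrite !big_cons /= mulSn addvCA addvC.
have := dim_submodular U (\sum_(j <- r) W j) (W j).
by move: IH; lia.
Qed.

Lemma dim_add_le1 (U L : {vspace vT}) :
  \dim L <= 1 -> \dim (U + L) = ~~ (L <= U)%VS + \dim U.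
Proof.
move=> dimL; case: (boolP (L <= U)%VS) => [/addv_idPl->//|nLU] /=.
have [le_dim eq_dim] := dimv_leqif_sup (addvSl U L).
have : \dim U != \dim (U + L) by rewrite eq_dim subv_add subvv.
have := dimv_sum_cap U L.
lia.
Qed.

Lemma greedy_weight_split wt1 wt2 wt U s :
  {in s, forall e, wt e = wt1 e + wt2 e} ->
  greedy_weight wt U s = greedy_weight wt1 U s + greedy_weight wt2 U s.
Proof.
elim: s U => //= e s IH U wtE.
rewrite IH => [|e' e's]; last by rewrite wtE // inE e's orbT.
by rewrite (wtE e) ?mem_head //; case: ifP; lia.
Qed.

(** Each element paid for raises the dimension by exactly one, so the sum telescopes. *)
Lemma greedy_weight_const k U s : {in s, forall e, \dim (V e) <= 1} ->
  greedy_weight (fun=> k) U s + k * \dim U = k * \dim (U + join s).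
Proof.
elim: s U => [|e s IH] U dim1 /=; first by rewrite /join big_nil addv0.
have dims : {in s, forall e, \dim (V e) <= 1}.
  by move=> e' e's; rewrite dim1 // inE e's orbT.
rewrite /join big_cons -/(join s) addvA -(IH _ dims) (@dim_add_le1 U) ?dim1 ?mem_head //.
by case: ifP => _ /=; lia.
Qed.

Lemma greedy_weight_mono wt (U U' : {vspace vT}) s : (U <= U')%VS ->
  greedy_weight wt U' s <= greedy_weight wt U s.
Proof.
elim: s U U' => //= e s IH U U' leU; apply: leq_add; last by apply/IH/addvS.
by case: (boolP (V e <= U)%VS) => [/subv_trans->|_] //; case: ifP.
Qed.

(* Subtracting the smallest weight from all the others leaves an instance in
   which the first element is free; the part subtracted is a multiple of a
   dimension, for which the claim is submodularity. *)
Lemma greedy_weight_sum_drops (J : eqType) (r : seq J) (W : J -> {vspace vT}) wt U s :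
  sorted leq (map wt s) -> {in s, forall e, \dim (V e) <= 1} ->
  (U + \sum_(j <- r) W j = U + join s)%VS ->
  \sum_(j <- r) greedy_weight wt (U + W j) s + greedy_weight wt U s <=
  size r * greedy_weight wt U s.
Proof.
elim: s wt U => [|e s IH] wt U sorted_s dim1 spanW.
  by rewrite big1_seq // muln0.
rewrite /= in sorted_s; have min_e : {in s, forall f, wt e <= wt f}.
  move=> f fs; have := order_path_min leq_trans sorted_s.
  by move/allP; apply; rewrite map_f.
have dims : {in s, forall e, \dim (V e) <= 1}.
  by move=> e' e's; rewrite dim1 // inE e's orbT.
pose wt' f := wt f - wt e.
have gwE U1 : greedy_weight wt U1 (e :: s) =
    greedy_weight (fun=> wt e) U1 (e :: s) + greedy_weight wt' (U1 + V e) s.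
  rewrite (@greedy_weight_split (fun=> wt e) wt'); last first.
    by move=> f; rewrite inE /wt' => /predU1P[->|/min_e]; lia.
  by congr (_ + _); rewrite /= /wt' subnn; case: ifP.
have sorted' : sorted leq (map wt' s).
  rewrite (eq_map (g := (fun x => x - wt e) \o wt)) // map_comp.
  apply: (homo_sorted (e := leq)); last exact: path_sorted sorted_s.
  by move=> x y; apply: leq_sub2r.
have spanW' : (U + V e + \sum_(j <- r) W j = U + V e + join s)%VS.
  have joinE : join (e :: s) = (V e + join s)%VS by rewrite /join big_cons.
  rewrite -[RHS]addvA -joinE -spanW addvAC spanW joinE; apply/addv_idPl.
  exact: subv_trans (addvSl _ _) (addvSr _ _).
have le' := IH wt' (U + V e)%VS sorted' dims spanW'.
have leC : \sum_(j <- r) greedy_weight (fun=> wt e) (U + W j) (e :: s) +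
    greedy_weight (fun=> wt e) U (e :: s) <=
    size r * greedy_weight (fun=> wt e) U (e :: s).
  set D := \dim (U + join (e :: s)).
  have eqU := greedy_weight_const (wt e) U _ dim1.
  (* Every [U + W j] is completed to the same dimension [D], because [W j] already lies in the span
     of [U] and the sequence. *)
  have eqW : \sum_(j <- r) greedy_weight (fun=> wt e) (U + W j) (e :: s) +
      wt e * (\sum_(j <- r) \dim (U + W j)) = size r * (wt e * D).
    have eqj j : j \in r -> greedy_weight (fun=> wt e) (U + W j) (e :: s) +
        wt e * \dim (U + W j) = wt e * D.
      move=> rj; rewrite greedy_weight_const // /D addvAC; congr (_ * \dim _).
      apply/addv_idPl; rewrite -spanW; apply: subv_trans (addvSr _ _).
      by rewrite (big_rem j) //= addvSl.
    rewrite big_distrr -big_split (eq_big_seq (fun=> wt e * D) eqj).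
    by rewrite big_const_seq count_predT iter_addn_0 mulnC.
  have := dim_sum_increments _ r U W; rewrite spanW -/D => inc.
  rewrite -/D in eqU.
  have {}inc := leq_mul (leqnn (wt e)) inc.
  nia.
under eq_bigr => j _ do rewrite gwE (addvAC U).
rewrite gwE big_split mulnDr.
by rewrite addnACA leq_add.
Qed.

End GreedyWeight.

(** Unfolds the recursion: the accumulated space is the span of the elements with smaller key. In
    this form each element is tested independently of the others, as in [kruskal]. *)
Lemma greedy_weight_prefix (K : fieldType) (vT : vectType K) (I : eqType)
    (V : I -> {vspace vT}) (wt key : I -> nat) U s : sorted ltn (map key s) ->
  greedy_weight K vT I V wt U s =
  \sum_(e <- s)
    if (V e <= U + \sum_(f <- s | key f < key e) V f)%VS then 0 else wt e.
Proof.
elim: s U => [|e s IH] U /= sorted_s; first by rewrite big_nil.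
have min_e : {in s, forall f, key e < key f}.
  move=> f fs; have := order_path_min ltn_trans sorted_s.
  by move/allP; apply; rewrite map_f.
rewrite IH ?(path_sorted sorted_s) // big_cons; congr (_ + _).
  rewrite big_cons ltnn big_seq_cond big1 ?addv0 // => f /andP[/min_e].
  by case: ltngtP.
by apply: eq_big_seq => f fs; rewrite big_cons min_e // addvA.
Qed.

(** * Spanning sets of hyperedges *)

Section Hyperedges.

Variables (n m : nat) (A : 'I_m -> {set 'I_n}).

Definition diff (u v : 'I_n) : 'rV[rat]_n := (delta_mx 0 u - delta_mx 0 v)%R.

Definition edge_space (i : 'I_m) : {vspace 'rV[rat]_n} :=
  (\sum_(u in A i) \sum_(v in A i) <[diff u v]>)%VS.

Definition edges_span (C : {set 'I_m}) : {vspace 'rV[rat]_n} :=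
  (\sum_(i in C) edge_space i)%VS.

Lemma diffC u v : diff v u = (- diff u v)%R.
Proof. by rewrite /diff opprB. Qed.

Lemma diff_trans u v w : diff u w = (diff u v + diff v w)%R.
Proof. by rewrite /diff addrA subrK. Qed.

Lemma mem_diff_trans (U : {vspace 'rV[rat]_n}) u v w :
  diff u v \in U -> diff v w \in U -> diff u w \in U.
Proof. by rewrite (diff_trans u v w); apply: memvD. Qed.

Lemma edge_space_subP i (U : {vspace 'rV[rat]_n}) :
  reflect {in A i &, forall u v, diff u v \in U} (edge_space i <= U)%VS.
Proof.
apply: (iffP subv_sumP) => [sub u v Au Av|sub u Au].
  by have /subv_sumP/(_ v Av) := sub u Au; rewrite -memvE.
by apply/subv_sumP => v Av; rewrite -memvE sub.
Qed.

(** The differences from one root generate all the others, so a search from a single vertex of the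
    hyperedge decides the inclusion. *)
Lemma edge_space_root i r (U : {vspace 'rV[rat]_n}) : r \in A i ->
  (edge_space i <= U)%VS = [forall v in A i, diff r v \in U].
Proof.
move=> Ar; apply/edge_space_subP/forall_inP => [sub v Av|sub u v Au Av].
  exact: sub.
by apply: mem_diff_trans (sub v Av); rewrite diffC memvN sub.
Qed.

Lemma edge_space_le_span (C : {set 'I_m}) i : i \in C -> (edge_space i <= edges_span C)%VS.
Proof. by move=> Ci; apply: (sumv_sup i). Qed.

Lemma edges_spanS (C D : {set 'I_m}) : C \subset D -> (edges_span C <= edges_span D)%VS.
Proof. by move=> /subsetP sCD; apply/subv_sumP => i /sCD; apply: edge_space_le_span. Qed.

Lemma edges_spanU C D : edges_span (C :|: D) = (edges_span C + edges_span D)%VS.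
Proof.
apply/eqP; rewrite eqEsubv subv_add !edges_spanS ?subsetUl ?subsetUr // !andbT.
apply/subv_sumP => i; rewrite inE => /orP[] Ci.
  exact: subv_trans (edge_space_le_span _ _ Ci) (addvSl _ _).
exact: subv_trans (edge_space_le_span _ _ Ci) (addvSr _ _).
Qed.

Lemma edges_span1 i : edges_span [set i] = edge_space i.
Proof. by rewrite /edges_span big_set1. Qed.

Lemma dim_edge_space i : #|A i| = 2 -> \dim (edge_space i) <= 1.
Proof.
move=> /eqP/cards2P[a [b [_ Ai]]].
suff sub : (edge_space i <= <[diff a b]>)%VS.
  by apply: leq_trans (dimvS sub) _; rewrite dim_vline; case: eqP.
apply/edge_space_subP => u v; rewrite Ai !inE.
have diff0 w : diff w w = 0%R by rewrite /diff subrr.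
by move=> /orP[] /eqP-> /orP[] /eqP->; rewrite ?diff0 ?mem0v ?memv_line //
  diffC memvN memv_line.
Qed.

(* The indicator of a set of vertices closed under the hyperedges of C is a
   linear form that vanishes on the span of C. *)
Lemma closed_separates (C : {set 'I_m}) (X : {set 'I_n}) r v :
  {in C, forall i, A i :&: X != set0 -> A i \subset X} ->
  r \in X -> diff r v \in edges_span C -> v \in X.
Proof.
move=> closedX Xr; pose x : 'cV[rat]_n := (\col_u (u \in X)%:R)%R.
have diffE u w : (diff u w *m x = ((u \in X)%:R - (w \in X)%:R)%:M)%R.
  rewrite mulmxBl -!rowE; apply/matrixP => i j; rewrite !ord1 !mxE.
  by rewrite eqxx mulr1n.
have /subvP sub : (edges_span C <= lker (linfun (mulmxr x)))%VS.
  apply/subv_sumP => i Ci; apply/edge_space_subP => u w Au Aw.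
  rewrite memv_ker lfunE /= diffE.
  suff -> : (u \in X) = (w \in X) by rewrite subrr raddf0.
  have inX u' : u' \in A i -> u' \in X -> A i \subset X.
    by move=> Au' Xu'; apply: closedX => //; apply/set0Pn; exists u'; rewrite inE Au'.
  by apply/idP/idP => [/(inX _ Au)|/(inX _ Aw)] /subsetP; apply.
move=> /sub; rewrite memv_ker lfunE /= diffE Xr; case: (v \in X) => //.
by rewrite subr0 => /eqP/matrixP/(_ 0 0)%R/eqP; rewrite !mxE eqxx mulr1n oner_eq0.
Qed.

Definition spanning (C : {set 'I_m}) : Prop := forall u v, diff u v \in edges_span C.

(** Along a path the differences telescope. Conversely, the connected component of [u] is closed
    under the hyperedges, so [closed_separates] places every [v] in it. *)
Lemma connected_spanningP (C : {set 'I_m}) :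
  connected_spanning (A @: C) <-> spanning C.
Proof.
split=> [conn u v|span].
  have /forallP/(_ u)/forallP/(_ v)/connectP[p] := conn.
  elim: p u => [|w p IH] u /=; first by move=> _ ->; rewrite /diff subrr mem0v.
  case/andP=> /exists_inP[_ /imsetP[i Ci ->] /andP[Au Aw]] path_p last_v.
  apply: mem_diff_trans (IH w path_p last_v).
  by move/edge_space_subP: (edge_space_le_span _ _ Ci); apply.
apply/forallP => u; apply/forallP => v.
have := @closed_separates C [set w | connect (coincident (A @: C)) u w] u v.
rewrite !inE connect0 => -> // i Ci /set0Pn[w]; rewrite !inE => /andP[Aw uw].
apply/subsetP => w' Aw'; rewrite inE; apply: connect_trans uw (connect1 _).
by apply/exists_inP; exists (A i); [exact: imset_f|rewrite Aw].
Qed.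

Lemma spanning_span C D : spanning C -> spanning D -> edges_span C = edges_span D.
Proof.
move=> spanC spanD; apply/eqP; rewrite eqEsubv.
by apply/andP; split; apply/subv_sumP => i _; apply/edge_space_subP.
Qed.

(** * Kruskal completions and the drops they define *)

Variables (wt : 'I_m -> nat) (T : {set 'I_m}).

(* Compares hyperedges by weight, ties being broken by index. *)
Definition key (i : 'I_m) : nat := wt i * m + i.

Definition before (e : 'I_m) : {set 'I_m} := [set f in T | key f < key e].

(** The test involves all earlier tree hyperedges and not only those kept: the rejected ones add
    nothing to the span, and each hyperedge can then be tested on its own. *)
Definition kruskal (C : {set 'I_m}) : {set 'I_m} :=
  [set e in T | ~~ (edge_space e <= edges_span (C :|: before e))%VS].

Definition mst (C : {set 'I_m}) : nat := \sum_(e in kruskal C) wt e.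

Lemma kruskal_sub C : kruskal C \subset T.
Proof. by apply/subsetP => e; rewrite inE => /andP[]. Qed.

Lemma key_inj : injective key.
Proof.
move=> i j /(congr1 (fun k => k %% m)).
by rewrite /key !modnMDl !modn_small // => /val_inj.
Qed.

(** By induction on the key: a rejected hyperedge lies in the span of [C] and of earlier tree
    hyperedges, which are already accounted for. *)
Lemma kruskal_span C : edges_span (C :|: kruskal C) = edges_span (C :|: T).
Proof.
apply/eqP; rewrite eqEsubv edges_spanS ?setUS ?kruskal_sub //=.
apply/subv_sumP => i; rewrite inE; case/orP=> [Ci|].
  by apply: edge_space_le_span; rewrite inE Ci.
have [k] := ubnP (key i); elim: k i => // k IH i lt_k Ti.
case: (boolP (i \in kruskal C)) => [Ki|].
  by apply: edge_space_le_span; rewrite inE Ki orbT.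
rewrite inE Ti negbK => /subv_trans; apply; apply/subv_sumP => f.
rewrite inE => /orP[Cf|]; first by apply: edge_space_le_span; rewrite inE Cf.
by rewrite inE => /andP[Tf lt_f]; apply: IH Tf; apply: leq_trans lt_f _.
Qed.

Definition sorted_tree : seq 'I_m :=
  sort (fun e f => key e <= key f) (enum T).

Lemma mem_sorted_tree : sorted_tree =i T.
Proof. by move=> e; rewrite mem_sort mem_enum. Qed.

Lemma sorted_tree_key : sorted ltn (map key sorted_tree).
Proof.
rewrite ltn_sorted_uniq_leq map_inj_uniq ?sort_uniq ?enum_uniq ?sorted_map //=.
  by apply: sort_sorted => e f; exact: leq_total.
exact: key_inj.
Qed.

Lemma sorted_tree_wt : sorted leq (map wt sorted_tree).
Proof.
have := sorted_tree_key; rewrite !sorted_map; apply: sub_sorted => e f /=.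
by rewrite /relpre /= /key; have := ltn_ord e; have := ltn_ord f; nia.
Qed.

Lemma join_sorted_tree : join _ _ _ edge_space sorted_tree = edges_span T.
Proof.
rewrite /join /edges_span (perm_big (enum T)) ?big_enum //.
by rewrite perm_sort.
Qed.

Lemma mst_greedy_weight C :
  mst C = greedy_weight _ _ _ edge_space wt (edges_span C) sorted_tree.
Proof.
rewrite (greedy_weight_prefix _ _ _ _ _ _ _ _ sorted_tree_key).
rewrite (perm_big (enum T)) ?perm_sort // big_enum /=.
rewrite /mst big_mkcond [RHS]big_mkcond; apply: eq_bigr => e _.
rewrite inE; case: (e \in T) => //=.
suff -> : (\sum_(f <- sorted_tree | key f < key e) edge_space f)%VS =
    edges_span (before e) by rewrite edges_spanU; case: (_ <= _)%VS.
rewrite (perm_big (enum T)) ?perm_sort // big_enum_cond.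
by apply: eq_bigl => f; rewrite inE.
Qed.

Lemma mst_mono (C D : {set 'I_m}) : C \subset D -> mst D <= mst C.
Proof.
by move=> sCD; rewrite !mst_greedy_weight greedy_weight_mono ?edges_spanS.
Qed.

Hypothesis T2 : {in T, forall e, #|A e| = 2}.
Hypothesis spanT : spanning T.

Lemma kruskal_spanning C : spanning (C :|: kruskal C).
Proof.
by move=> u v; rewrite kruskal_span; apply: subvP (spanT u v); apply/edges_spanS/subsetUr.
Qed.

Definition drop (C : {set 'I_m}) (b : 'I_m) : nat := mst C - mst (b |: C).

(** This is [greedy_weight_sum_drops] started at the span of [C], with the hyperedges of [B] as the
    added subspaces; [B] and [T] have the same span because both are spanning. *)
Lemma mst_le_sum_drops C B : spanning B -> mst C <= \sum_(b in B) drop C b.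
Proof.
move=> spanB.
have dropE b : drop C b + mst (b |: C) = mst C by rewrite subnK // mst_mono ?subsetUr.
have sumE : \sum_(b in B) drop C b + \sum_(b in B) mst (b |: C) = #|B| * mst C.
  by rewrite -big_split /= (eq_bigr _ (fun b _ => dropE b)) sum_nat_const.
suff : \sum_(b in B) mst (b |: C) + mst C <= #|B| * mst C by rewrite -sumE; lia.
have := greedy_weight_sum_drops _ _ _ edge_space _ (enum B) edge_space wt
  (edges_span C) _ sorted_tree_wt.
rewrite join_sorted_tree -cardE !big_enum -mst_greedy_weight => le_sum.
rewrite (eq_bigr (fun b => greedy_weight _ _ _ edge_space wt
  (edges_span C + edge_space b) sorted_tree)); last first.
  by move=> b _; rewrite mst_greedy_weight setUC edges_spanU edges_span1.
apply: le_sum; first by move=> e; rewrite mem_sorted_tree => /T2/dim_edge_space.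
by rewrite (spanning_span T B).
Qed.

Definition stuck (C : {set 'I_m}) : Prop := forall b, drop C b <= wt b.

(** The ratio of drop to weight is maximised in cross-multiplied form, so that weight 0 needs no
    special case. The first alternative is an idle round, when no ratio exceeds 1. *)
Definition greedy_step (C C' : {set 'I_m}) : Prop :=
  (C' = C /\ stuck C) \/
  exists a, [/\ C' = a |: C, wt a < drop C a &
                forall b, drop C b * wt a <= drop C a * wt b].

Definition weight (B : {set 'I_m}) : nat := \sum_(b in B) wt b.

Lemma stuck_mst_le C B : spanning B -> stuck C -> mst C <= weight B.
Proof.
by move=> spanB stuckC; apply: leq_trans (mst_le_sum_drops C B spanB) (leq_sum _ _).
Qed.

Lemma best_ratio_bound C B a : spanning B ->
  (forall b, drop C b * wt a <= drop C a * wt b) ->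
  wt a * mst C <= drop C a * weight B.
Proof.
move=> spanB best; rewrite mulnC.
apply: leq_trans (leq_mul (mst_le_sum_drops C B spanB) (leqnn _)) _.
by rewrite big_distrl big_distrr leq_sum.
Qed.

End Hyperedges.

(** * The logarithmic potential *)

Section Potential.

Variable R : realType.
Local Open Scope ring_scope.

Definition potential (tau x : R) : R :=
  if x <= tau then x else tau * (1 + ln (x / tau)).

(** The inequality [ln y <= y - 1] at [y = x^-1]. *)
Lemma ln_ge1V (x : R) : 0 < x -> 1 - x^-1 <= ln x.
Proof.
move=> x0; have := @le_ln1Dx R (x^-1 - 1).
rewrite [1 + _]addrC subrK lnV ?posrE // ltrBrDr addrC subrr invr_gt0 => /(_ x0).
lra.
Qed.

(** If [x <= tau], both values lie on the linear branch and [c < d] suffices. If [x - d] still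
    exceeds [tau], then [ln (x / (x - d)) >= d / x], so the potential falls by at least
    [tau * (d / x) >= c]. The remaining case crosses [tau]. *)
Lemma potential_step (tau x d c : R) : 0 <= tau -> d <= x -> 0 <= c -> c < d ->
  c * x <= d * tau -> c + potential tau (x - d) <= potential tau x.
Proof.
move=> tau0 le_dx c0 lt_cd ratio.
have d0 : 0 < d by lra.
have x0 : 0 < x by lra.
rewrite /potential; have [le_x|lt_x] := leP x tau.
  by rewrite ifT; lra.
(* For [tau = 0] the ratio hypothesis forces [c = 0], and the potential of every nonnegative
   argument is 0. *)
have [tau00|tau_neq0] := eqVneq tau 0.
  have c00 : c = 0.
    apply/eqP; rewrite eq_le c0 andbT.
    by move: ratio; rewrite tau00 mulr0 pmulr_lle0.
  by rewrite c00 tau00 !mul0r add0r; case: ifP.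
have tau_gt0 : 0 < tau by rewrite lt_neqAle eq_sym tau_neq0.
have x_unit : x != 0 by rewrite gt_eqF.
have c_le : c <= tau * (d / x) by rewrite mulrA ler_pdivlMr // (mulrC tau).
have [le_xd|lt_xd] := leP (x - d) tau.
  have := ln_ge1V (x / tau); rewrite divr_gt0 // invf_div => /(_ isT) lnx.
  have lnx' := ler_wpM2l (ltW tau_gt0) lnx.
  (* Crossing step: once [ln (x / tau)] is replaced by [1 - tau / x] and [c] by [tau * (d / x)], the
     slack left in the inequality factors as this product. *)
  have : 0 <= (1 - tau / x) * (tau - (x - d)).
    by rewrite mulr_ge0 ?subr_ge0 // ler_pdivrMr // mul1r ltW.
  have -> : (1 - tau / x) * (tau - (x - d)) =
    tau - x + d - tau * (d / x) + tau * (1 - tau / x) by field.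
  lra.
have xd0 : 0 < x - d by lra.
have lnE : ln (x / tau) = ln ((x - d) / tau) + ln (x / (x - d)).
  rewrite -lnM ?posrE ?divr_gt0 //; congr (ln _); field.
  by rewrite tau_neq0 gt_eqF.
have := ln_ge1V (x / (x - d)); rewrite divr_gt0 // invf_div => /(_ isT) lnx.
have lnx' := ler_wpM2l (ltW tau_gt0) lnx.
have dE : 1 - (x - d) / x = d / x by field.
rewrite lnE; rewrite dE in lnx'.
lra.
Qed.

Lemma potential_le (tau x w : R) : 0 <= tau -> tau <= w -> x <= w ->
  potential tau x <= tau * (1 + ln (w / tau)).
Proof.
rewrite le_eqVlt => /predU1P[<- w0 le_xw|tau0 le_tw le_xw].
  by rewrite /potential !mul0r; case: ifP.
rewrite /potential; case: (leP x tau) => [le_x|lt_x].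
  apply: le_trans le_x _; rewrite mulrDr mulr1 lerDl mulr_ge0 ?(ltW tau0) //.
  by rewrite ln_ge0 // ler_pdivlMr // mul1r.
rewrite ler_pM2l // lerD2l ler_ln ?posrE ?divr_gt0 //; last 2 first.
- exact: lt_trans lt_x.
- exact: lt_le_trans le_tw.
by rewrite ler_pM2r ?invr_gt0.
Qed.

Section Greedy.

Variables (n m : nat) (A : 'I_m -> {set 'I_n}) (wt : 'I_m -> nat) (T : {set 'I_m}).
Hypothesis T2 : {in T, forall e, #|A e| = 2%N}.
Hypothesis spanT : spanning n m A T.
Variable B : {set 'I_m}.
Hypothesis spanB : spanning n m A B.

Local Notation mst := (mst n m A wt T).
Local Notation weight := (weight m wt).
Local Notation stuck := (stuck n m A wt T).

(** [B] is any spanning set to compare with. The second part counts rounds: each one either finds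
    the process stuck or adds a new hyperedge. *)
Definition greedy_invariant (k : nat) (C : {set 'I_m}) : Prop :=
  (weight C)%:R + potential (weight B)%:R (mst C)%:R
    <= potential (weight B)%:R (mst set0)%:R /\ (stuck C \/ (k <= #|C|)%N).

Lemma greedy_invariant0 : greedy_invariant 0 set0.
Proof. by split; [rewrite /weight big_set0 add0r|right]. Qed.

Lemma greedy_invariant_step k C C' : greedy_step n m A wt T C C' ->
  greedy_invariant k C -> greedy_invariant k.+1 C'.
Proof.
case=> [[-> stuckC] [pot _]|[a [-> lt_a best] [pot grown]]]; first by split=> //; left.
(* A hyperedge already in [C] has drop 0, which cannot exceed its weight. *)
have a_C : a \notin C.
  apply: contraL lt_a => Ca; rewrite /drop.
  by have -> : a |: C = C; [apply/setUidPr; rewrite sub1set|rewrite subnn].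
split; last first.
  by right; rewrite cardsU1 a_C; case: grown => // /(_ a); rewrite leqNgt lt_a.
apply: le_trans pot; rewrite /weight big_setU1 //= natrD -addrA addrCA lerD2l.
have le_mst : (mst (a |: C) <= mst C)%N by rewrite mst_mono ?subsetUr.
have -> : (mst (a |: C))%:R = (mst C)%:R - (drop n m A wt T C a)%:R :> R.
  by rewrite -natrB ?leq_subr // subKn.
apply: potential_step; rewrite ?ler0n ?ltr_nat ?ler_nat ?leq_subr //.
by rewrite -!natrM ler_nat best_ratio_bound.
Qed.

Lemma greedy_invariant_end C : (weight B <= weight T)%N -> greedy_invariant m C ->
  (weight (C :|: kruskal n m A wt T C))%:R <=
  (weight B)%:R * (1 + ln ((weight T)%:R / (weight B)%:R)) :> R.
Proof.
move=> le_BT [pot grown].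
(* With [m] elements [C] is everything, and then all drops vanish. *)
have stuckC : stuck C.
  case: grown => // le_m b; suff -> : C = setT by rewrite /drop setUT subnn.
  by apply/eqP; rewrite eqEcard subsetT cardsT card_ord.
have mst_le : (mst C <= weight B)%N by exact: stuck_mst_le.
have le_wt : (weight (C :|: kruskal n m A wt T C) <= weight C + mst C)%N.
  rewrite /weight /mst big_mkcond [\sum_(b in C) _]big_mkcond.
  rewrite [\sum_(b in kruskal _ _ _ _ _ _) _]big_mkcond -big_split.
  apply: leq_sum => b _; rewrite in_setU.
  by case: (b \in C) => /=; [exact: leq_addr|].
(* Since the process is stuck, [mst C <= weight B], so the final potential is on its linear branch
   and equals [mst C]. *)
apply: le_trans (le_trans pot _).
  by rewrite /potential ler_nat mst_le -natrD ler_nat.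
apply: potential_le; rewrite ?ler0n ?ler_nat //.
rewrite /weight /mst big_mkcond [leqRHS]big_mkcond leq_sum // => e _.
by rewrite inE; case: (e \in T) => //=; case: ifP.
Qed.

End Greedy.

End Potential.

(** * Polynomial running time on input words *)

Lemma computes_poly p : wf p ->
  exists q : {poly nat}, forall w, 1 < size w ->
    nth 0 w 0 <= word_size w -> nth 0 w 1 <= word_size w ->
    computes_within (compile p) w q.[word_size w]%R (output (run p (input_memory w))).
Proof.
move=> /compile_poly[q1 [q2 runs]].
exists (q1 * ('X + q2))%R => w size_w loop0 loop1.
set W := word_size w.
have bit_x x : x \in w -> bitlen x <= W.
  by move=> xw; rewrite /W /word_size (big_rem x) //= leq_addr.
have bit_gt0 x : 0 < bitlen x by [].
have size_W : size w <= W.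
  by rewrite -sum1_size /W /word_size leq_sum.
have bit_size : bitlen (size w) <= W.
  apply: leq_trans size_W; case: (size w) size_w => // -[//|k] _.
  by apply: bitlen_lt; rewrite ltn_expl.
have bits a i : bitlen (input_memory w a i) <= W.
  rewrite /input_memory; case: eqP => _; last by rewrite (leq_trans _ bit_size).
  case: (ltnP i (size w).+1) => [lt_i|le_i]; last first.
    by rewrite nth_default // (leq_trans _ bit_size).
  by have := mem_nth 0 (lt_i : i < size (size w :: w)); rewrite inE => /predU1P[->//|/bit_x].
(* Cell 0 holds the length of the input, so the first two words of [w] are the loop counts in cells
   1 and 2. *)
have in_W : small_input W (input_memory w).
  by split=> [|||j]; rewrite ?bits // (leq_trans _ bit_size).
have [t [ex le_t _]] := runs W _ W in_W bits.
exists t, (run p (input_memory w)); split=> //.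
by rewrite hornerM hornerD hornerX.
Qed.

(** * Invariant rules for loops *)

Arguments run : simpl never.

Definition agree (ws : seq nat) (s t : memory) : Prop :=
  forall a j, a \notin ws -> t a j = s a j.

Lemma run_Then p1 p2 s : run (Then p1 p2) s = run p2 (run p1 s).
Proof. by []. Qed.

Lemma run_Assign a i e s : run (Assign a i e) s = update s a (eval s i) (eval s e).
Proof. by []. Qed.

Lemma update_eq s a i v : update s a i v a i = v.
Proof. by rewrite /update !eqxx. Qed.

Lemma update_same s a i v j : update s a i v a j = if j == i then v else s a j.
Proof. by rewrite /update eqxx. Qed.

(** The step may assume for free that the counter equals [i] and that all arrays not written by the
    loop are as at the start. *)
Lemma run_For (I : nat -> memory -> Prop) x k p s : wf (For x k p) ->
  I 0 (update s x 0 0) ->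
  (forall i t, i < s 0 k -> t x 0 = i -> agree (x :: writes p) s t -> I i t ->
     I i.+1 (update (run p t) x 0 i.+1)) ->
  I (s 0 k) (run (For x k p) s).
Proof.
move=> wf_for I0 step; have /and4P[x0 _ x_p wf_p] := wf_for.
rewrite [run _ s]/run -/run; set body := fun t => _.
suff loop i : i <= s 0 k -> [/\ iter i body (update s x 0 0) x 0 = i,
    agree (x :: writes p) s (iter i body (update s x 0 0)) &
    I i (iter i body (update s x 0 0))] by case: (loop _ (leqnn _)).
elim: i => [|i IH] le_i.
  split=> //=; first by rewrite update_eq.
  by move=> a j; rewrite inE negb_or => /andP[ax _]; rewrite update_neq.
have [xi agr Ii] := IH (ltnW le_i); rewrite iterS; set t := iter i body _ in xi agr Ii *.
have -> : body t = update (run p t) x 0 i.+1.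
  by rewrite /body /= (run_frame p t x 0 x_p) xi addn1.
split; [by rewrite update_eq| |exact: step].
move=> a j na; have := na; rewrite inE negb_or => /andP[ax ap].
by rewrite update_neq // run_frame // agr.
Qed.

(** Iteration [i] changes only cell [adr i] of [arr]; by injectivity no other iteration disturbs
    it. *)
Lemma For_map (arr : nat) (adr : nat -> nat) (g : nat -> nat -> nat) x k p s :
  wf (For x k p) -> arr != x -> injective adr ->
  (forall i t j, i < s 0 k -> t x 0 = i -> agree (x :: writes p) s t ->
     run p t arr j = if j == adr i then g i (t arr j) else t arr j) ->
  forall j, j < s 0 k -> run (For x k p) s arr (adr j) = g j (s arr (adr j)).
Proof.
move=> wf_for arr_x adr_inj step j lt_j.
pose I i (t : memory) := forall j, j < s 0 k ->
  t arr (adr j) = if j < i then g j (s arr (adr j)) else s arr (adr j).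
suff /(_ j lt_j) : I (s 0 k) (run (For x k p) s) by rewrite lt_j.
apply: run_For => // [j' _|i t lt_i ti agr It j' lt_j'].
  by rewrite update_neq.
rewrite update_neq // (step i) // (inj_eq adr_inj) It // ltnS.
by case: ltngtP => // <-.
Qed.

Lemma For_fold (h c : nat) (g : nat -> nat -> nat) x k p s :
  wf (For x k p) -> h != x ->
  (forall i t, i < s 0 k -> t x 0 = i -> agree (x :: writes p) s t ->
     run p t h c = g i (t h c)) ->
  run (For x k p) s h c = iteri (s 0 k) g (s h c).
Proof.
move=> wf_for h_x step.
pose I i (t : memory) := t h c = iteri i g (s h c).
apply: (run_For I) => // [|i t lt_i ti agr It]; first by rewrite /I update_neq.
by rewrite /I update_neq // (step i) // It.
Qed.

Lemma has_iotaS N (P : pred nat) : has P (iota 0 N.+1) = has P (iota 0 N) || P N.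
Proof. by rewrite -addn1 iotaD has_cat /= orbF. Qed.

Lemma iteri_flag N (P : pred nat) x :
  (iteri N (fun i b => if P i then 1 else b) x != 0) =
  (x != 0) || has P (iota 0 N).
Proof.
elim: N => [|N IH]; first by rewrite /= orbF.
by rewrite has_iotaS orbA -IH /=; case: (P N); rewrite ?orbT ?orbF.
Qed.

Lemma iteri_last N (P : pred nat) x : has P (iota 0 N) ->
  let r := iteri N (fun i y => if P i then i else y) x in P r && (r < N).
Proof.
elim: N => [|N IH] //; rewrite has_iotaS /=.
case: (boolP (P N)) => [PN _|_]; first by rewrite PN ltnSn.
by rewrite orbF => /IH /andP[-> lt_r]; rewrite ltnS ltnW.
Qed.

Lemma iteri_prod N (P : pred nat) (f : nat -> nat) x :
  iteri N (fun j y => if P j then y * f j else y) x =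
  x * \prod_(0 <= j < N | P j) f j.
Proof.
elim: N => [|N IH] /=; first by rewrite big_nil muln1.
rewrite IH big_mkcond [in RHS]big_mkcond big_nat_recr //= mulnA.
by case: (P N); rewrite ?muln1.
Qed.

Lemma has_iota_ord N (P : pred nat) : has P (iota 0 N) = [exists i : 'I_N, P i].
Proof.
apply/hasP/existsP => [[i]|[i Pi]].
  by rewrite mem_iota add0n => /andP[_ lt_i] Pi; exists (Ordinal lt_i).
by exists (i : nat); rewrite ?mem_iota //= add0n.
Qed.

Definition var (x : nat) : expr := Get x (Const 0).
Definition assign (x : nat) (e : expr) : prog := Assign x (Const 0) e.
Definition When (e : expr) (p : prog) : prog := Cond e p Nop.

Lemma run_When e p s : run (When e p) s = if eval s e != 0 then run p s else s.
Proof. by []. Qed.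

(** * The program *)

(** Names begin with [a] for arrays, [v] for scalars and [c] for loop counters; array 1 is the one
    read by [output]. *)
Definition aOut := 1.
Definition aWeight := 2.
Definition aReach := 3.
Definition aActive := 4.
Definition aTrial := 5.
Definition aKruskal := 6.
Definition aChosen := 7.
Definition vRoot := 8.
Definition vHit := 9.
Definition vMst := 10.
Definition vBase := 11.
Definition vBestDrop := 12.
Definition vBestWeight := 13.
Definition vBest := 14.
Definition cScale := 20.
Definition cFactor := 21.
Definition cTree := 22.
Definition cMark := 23.
Definition cVertex := 24.
Definition cSweep := 25.
Definition cEdge := 26.
Definition cCand := 27.
Definition cCopy := 28.
Definition cRound := 29.

Definition forVertices (x : nat) (p : prog) : prog := For x 1 p.
Definition forEdges (x : nat) (p : prog) : prog := For x 2 p.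

(* Input cells: hyperedge i occupies n + 3 cells starting at cell 3. *)
Definition field (x : nat) (off : expr) : expr :=
  Get 0 (Add (Add (Const 3) (Mul (var x) (Add (Get 0 (Const 1)) (Const 3)))) off).
Definition incidence (x y : nat) : expr := field x (var y).
Definition numerator (x : nat) : expr := field x (Get 0 (Const 1)).
Definition denominator (x : nat) : expr := field x (Add (Get 0 (Const 1)) (Const 1)).
Definition in_tree (x : nat) : expr := field x (Add (Get 0 (Const 1)) (Const 2)).
Definition at_ (a x : nat) : expr := Get a (var x).

(** The sum of the two truncated differences is nonzero exactly when the counters differ, so the
    hyperedge's own denominator is left out. *)
Definition scale_one : prog :=
  When (Add (Defs.Sub (var cScale) (var cFactor)) (Defs.Sub (var cFactor) (var cScale)))
    (Assign aWeight (var cScale) (Mul (at_ aWeight cScale) (denominator cFactor))).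

(* Multiplies every cost by the product of all the denominators. *)
Definition scale : prog :=
  forEdges cScale
    (Then (Assign aWeight (var cScale) (numerator cScale))
          (forEdges cFactor scale_one)).

(** In tests, products act as conjunctions and, further on, truncated differences as strict
    comparisons. Such products are admissible because [wf] restricts only stored values, not
    tests. *)
Definition detect : prog :=
  forVertices cVertex
    (When (Mul (incidence cEdge cVertex) (at_ aReach cVertex)) (assign vHit (Const 1))).

Definition mark : prog :=
  forVertices cVertex
    (When (incidence cEdge cVertex) (Assign aReach (var cVertex) (Const 1))).

Definition absorb : prog :=
  Then (assign vHit (Const 0)) (Then detect (When (var vHit) mark)).

Definition sweep : prog := forEdges cEdge (When (at_ aActive cEdge) absorb).

Definition clear : prog := forVertices cVertex (Assign aReach (var cVertex) (Const 0)).

Definition find_root : prog :=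
  forVertices cVertex (When (incidence cTree cVertex) (assign vRoot (var cVertex))).

Definition reach : prog :=
  Then clear (Then find_root (Then (Assign aReach (var vRoot) (Const 1))
    (forVertices cSweep sweep))).

Definition key_expr (x : nat) : expr :=
  Add (Mul (at_ aWeight x) (Get 0 (Const 2))) (var x).

Definition activate : prog :=
  forEdges cMark
    (Then (Assign aActive (var cMark) (at_ aTrial cMark))
          (When (Mul (in_tree cMark) (Defs.Sub (key_expr cTree) (key_expr cMark)))
             (Assign aActive (var cMark) (Const 1)))).

Definition keep_if_cut : prog :=
  forVertices cVertex
    (When (Mul (incidence cTree cVertex) (Defs.Sub (Const 1) (at_ aReach cVertex)))
       (Assign aKruskal (var cTree) (Const 1))).

Definition kruskal_one : prog :=
  Then (Assign aKruskal (var cTree) (Const 0))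
    (When (in_tree cTree)
       (Then activate (Then reach (Then keep_if_cut
          (When (at_ aKruskal cTree)
             (assign vMst (Add (var vMst) (at_ aWeight cTree)))))))).

Definition kruskal_prog : prog :=
  Then (assign vMst (Const 0)) (forEdges cTree kruskal_one).

Definition copy : prog :=
  forEdges cCopy (Assign aTrial (var cCopy) (at_ aChosen cCopy)).

(** Ratios of drop to weight are compared by cross multiplication. The strict comparison, started
    from the ratio 1/1, lets only ratios above 1 be selected. *)
Definition candidate : prog :=
  Then copy (Then (Assign aTrial (var cCand) (Const 1)) (Then kruskal_prog
    (When (Defs.Sub (Mul (Defs.Sub (var vBase) (var vMst)) (var vBestWeight))
                    (Mul (var vBestDrop) (at_ aWeight cCand)))
       (Then (assign vBestDrop (Defs.Sub (var vBase) (var vMst)))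
       (Then (assign vBestWeight (at_ aWeight cCand))
             (assign vBest (var cCand))))))).

(* When no candidate beats the initial ratio 1/1, vBest keeps the value m, and
   the last assignment hits a cell beyond the array. *)
Definition round : prog :=
  Then copy (Then kruskal_prog (Then (assign vBase (var vMst))
  (Then (assign vBestDrop (Const 1)) (Then (assign vBestWeight (Const 1))
  (Then (assign vBest (Get 0 (Const 2))) (Then (forEdges cCand candidate)
  (Assign aChosen (var vBest) (Const 1)))))))).

(** Output flags are shifted by one because cell 0 receives the length. [aKruskal] holds the
    completion of the final set, as [main] runs [kruskal_prog] once more just before. *)
Definition report : prog :=
  Then (forEdges cCand
          (When (Add (at_ aChosen cCand) (at_ aKruskal cCand))
             (Assign aOut (Add (var cCand) (Const 1)) (Const 1))))
       (assign aOut (Get 0 (Const 2))).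

Definition main : prog :=
  Then scale (Then (forEdges cRound round) (Then copy (Then kruskal_prog report))).

Lemma wf_main : wf main.
Proof. by []. Qed.

(** * Correctness of the program *)

Section Correctness.

Variable inp : nat -> nat.
Local Notation n := (inp 1).
Local Notation m := (inp 2).

Definition loaded (s : memory) : Prop := forall j, s 0 j = inp j.

Lemma loaded_run p s : wf p -> loaded s -> loaded (run p s).
Proof. by move=> wf_p ld j; rewrite run_frame ?wf_keeps_input. Qed.

Lemma loaded_agree ws s t : 0 \notin ws -> agree ws s t -> loaded s -> loaded t.
Proof. by move=> n0 agr ld j; rewrite agr. Qed.

Lemma loaded_update s a i v : a != 0 -> loaded s -> loaded (update s a i v).
Proof. by move=> a0 ld j; rewrite update_neq 1?eq_sym. Qed.

Definition word (i off : nat) : nat := inp (3 + i * (n + 3) + off).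

Definition edge (i : 'I_m) : {set 'I_n} := [set v : 'I_n | word i v != 0].

Definition tree : {set 'I_m} := [set i : 'I_m | word i (n + 2) != 0].

Definition scaled (i : nat) : nat :=
  word i n * \prod_(0 <= j < m | j != i) word j (n + 1).

Definition wgt (i : 'I_m) : nat := scaled i.

Lemma eval_field s x off : loaded s -> eval s (field x off) = word (s x 0) (eval s off).
Proof. by move=> ld; rewrite /= !ld. Qed.

Lemma scale_spec s : loaded s -> forall i, i < m -> run scale s aWeight i = scaled i.
Proof.
move=> ld i lt_i; rewrite /scale /forEdges.
rewrite (For_map aWeight id (fun i _ => scaled i)) //; last by rewrite ld.
move=> {lt_i}i t j; rewrite ld => lt_i ti agr.
have ldt : loaded t by exact: loaded_agree agr ld.
rewrite run_Then run_Assign [eval t (var _)]/= ti.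
set t1 := update _ _ _ _.
have ld1 : loaded t1 by exact: loaded_update.
have t1i : t1 cScale 0 = i by rewrite /t1 update_neq.
have [->|neq_ji] := eqVneq j i; last first.
  pose g (_ x : nat) := x.
  rewrite (For_fold _ _ g) //.
    by rewrite -[RHS](_ : t1 aWeight j = _); [elim: (t1 0 2)|rewrite /t1 update_same (negPf neq_ji)].
  move=> k t' lt_k t'k agr'; rewrite run_When run_Assign; case: ifP => // _.
  by rewrite update_same /= agr' // t1i (negPf neq_ji).
rewrite (For_fold _ _ (fun k x => if k != i then x * word k (n + 1) else x)) //.
  by rewrite iteri_prod ld1 /t1 update_eq eval_field // ti [eval t _]/= ldt.
move=> k t' _ t'k agr'; rewrite run_When run_Assign.
have ld' : loaded t' by exact: loaded_agree agr' ld1.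
have t'i : t' cScale 0 = i by rewrite agr'.
have -> : (eval t' (Add (Defs.Sub (var cScale) (var cFactor))
    (Defs.Sub (var cFactor) (var cScale))) != 0) = (k != i).
  by rewrite /= t'k t'i; lia.
case: ifP => // _; rewrite update_same [eval t' (var _)]/= t'i eqxx.
rewrite -[eval t' _]/(t' aWeight (t' cScale 0) * eval t' (denominator cFactor)).
by rewrite t'i eval_field //= t'k ld'.
Qed.

Definition flags (k a : nat) (s : memory) : {set 'I_k} := [set i : 'I_k | s a i != 0].

Lemma flags_eq k a s t : (forall j, t a j = s a j) -> flags k a t = flags k a s.
Proof. by move=> eq_a; apply/setP => i; rewrite !inE eq_a. Qed.

Lemma detect_spec s (a : 'I_m) : loaded s -> s cEdge 0 = a -> s vHit 0 = 0 ->
  (run detect s vHit 0 != 0) = (edge a :&: flags n aReach s != set0).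
Proof.
move=> ld sa hit0; rewrite /detect /forVertices.
rewrite (For_fold _ _ (fun i b => if (word a i != 0) && (s aReach i != 0) then 1 else b)) //.
  rewrite (iteri_flag _ (fun i => (word a i != 0) && (s aReach i != 0))) hit0 ld.
  rewrite has_iota_ord; apply/existsP/set0Pn => -[v v_in]; exists v.
    by rewrite !inE.
  by move: v_in; rewrite !inE.
move=> i t _ ti agr; have ldt : loaded t by exact: loaded_agree agr ld.
rewrite run_When run_Assign.
rewrite -[eval t (Mul _ _)]/(eval t (incidence cEdge cVertex) * eval t (at_ aReach cVertex)).
rewrite eval_field // muln_eq0 negb_or /= ti (agr cEdge) // (agr aReach) // sa.
by case: ifP => //; rewrite update_eq.
Qed.

Lemma mark_spec s (a : 'I_m) : loaded s -> s cEdge 0 = a ->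
  flags n aReach (run mark s) = flags n aReach s :|: edge a.
Proof.
move=> ld sa; apply/setP => v; rewrite !inE /mark /forVertices.
rewrite (For_map aReach id (fun i x => if word a i != 0 then 1 else x)) ?ld //.
  by case: ifP => _; rewrite ?orbT ?orbF.
move=> i t j _ ti agr; have ldt : loaded t by exact: loaded_agree agr ld.
rewrite run_When run_Assign eval_field //= ti (agr cEdge) // sa.
by case: (word a i != 0); [rewrite update_same|case: ifP].
Qed.

Lemma absorb_spec s (a : 'I_m) : loaded s -> s cEdge 0 = a ->
  flags n aReach (run absorb s) =
  if edge a :&: flags n aReach s != set0 then flags n aReach s :|: edge a
  else flags n aReach s.
Proof.
move=> ld sa; rewrite /absorb !run_Then run_When run_Assign.
set s1 := update _ _ _ _; rewrite [eval _ _]/=.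
have ld1 : loaded s1 by exact: loaded_update.
have eq1 j : s1 aReach j = s aReach j by rewrite /s1 update_neq.
rewrite (detect_spec s1 a) // ?/s1 ?update_eq ?update_neq // -/s1.
have eq2 j : run detect s1 aReach j = s aReach j by rewrite run_frame.
rewrite (flags_eq _ _ s s1) //; case: ifP => _; last exact: flags_eq.
rewrite (mark_spec _ a) ?(flags_eq _ _ s _ eq2) //; first exact: loaded_run.
by rewrite run_frame // /s1 update_neq.
Qed.

(** Any closed [Z] bounds the sweep from above. The lower bound speaks only of hyperedges meeting
    the set [X] present at the start, so the order in which hyperedges are scanned does not
    matter. *)
Lemma sweep_spec s (Z : {set 'I_n}) : loaded s ->
  let H := flags m aActive s in
  let X := flags n aReach s in
  let X' := flags n aReach (run sweep s) in
  {in H, forall a, edge a :&: Z != set0 -> edge a \subset Z} -> X \subset Z ->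
  [/\ X \subset X', X' \subset Z &
      {in H, forall a, edge a :&: X != set0 -> edge a \subset X'}].
Proof.
move=> ld H X X' closedZ sXZ.
pose I i (t : memory) := [/\ X \subset flags n aReach t, flags n aReach t \subset Z &
  forall a : 'I_m, a < i -> a \in H -> edge a :&: X != set0 ->
    edge a \subset flags n aReach t].
suff [sX sZ sH] : I (s 0 2) (run sweep s).
  by split=> // a Ha; apply: sH => //; rewrite ld.
apply: (run_For I) => [//||i t lt_i ti agr [sX sZ sH]].
  by rewrite /I (flags_eq _ _ s) => [|j]; rewrite ?update_neq //; split.
have lt_im : i < m by rewrite -ld.
pose a := Ordinal lt_im.
rewrite /I (flags_eq _ _ (run (When (at_ aActive cEdge) absorb) t)); last first.
  by move=> j; rewrite update_neq.
have ldt : loaded t by exact: loaded_agree agr ld.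
rewrite run_When /= ti.
have -> : (t aActive i != 0) = (a \in H) by rewrite inE agr.
have split_i (b : 'I_m) : b < i.+1 -> b != a -> b < i.
  by rewrite ltnS leq_eqVlt => /predU1P[eq_b /eqP[]|]//; apply: val_inj.
case: (boolP (a \in H)) => [Ha|nHa]; last first.
  split=> // b lt_b Hb; apply: sH => //; apply: split_i lt_b _.
  by apply: contraNneq nHa => <-.
rewrite (absorb_spec t a) //; set Y := flags n aReach t in sX sZ sH *.
have sYX : (edge a :&: X != set0) -> (edge a :&: Y != set0).
  case/set0Pn=> v /setIP[av Xv]; apply/set0Pn; exists v.
  by rewrite inE av (subsetP sX).
have sYZ : (edge a :&: Y != set0) -> (edge a :&: Z != set0).
  case/set0Pn=> v /setIP[av Yv]; apply/set0Pn; exists v.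
  by rewrite inE av (subsetP sZ).
case: ifP => hit; split=> //.
- exact: subset_trans sX (subsetUl _ _).
- by rewrite subUset sZ closedZ ?sYZ.
- move=> b lt_b Hb hitb; have [->|neq_b] := eqVneq b a; first exact: subsetUr.
  by apply: subset_trans (subsetUl _ _); apply: sH; rewrite ?split_i.
- move=> b lt_b Hb hitb; have [eq_b|neq_b] := eqVneq b a.
    by move: hitb; rewrite eq_b => /sYX; rewrite hit.
  by apply: sH; rewrite ?split_i.
Qed.

Local Notation span := (edges_span n m edge).

(* A set of vertices strictly smaller than the component of the root is not
   closed under the active hyperedges, so it grows in every sweep. *)
Lemma sweeps_spec s (r : 'I_n) : loaded s ->
  flags n aReach s = [set r] ->
  flags n aReach (run (forVertices cSweep sweep) s) =
  [set v | diff n r v \in span (flags m aActive s)].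
Proof.
move=> ld s_r; set H := flags m aActive s; set Z := [set v | _].
have Zr : r \in Z by rewrite inE /diff subrr mem0v.
have closedZ : {in H, forall a, edge a :&: Z != set0 -> edge a \subset Z}.
  move=> a Ha /set0Pn[u /setIP[au]]; rewrite inE => Zu; apply/subsetP => v av.
  rewrite inE; apply: mem_diff_trans Zu _.
  by have /edge_space_subP := edge_space_le_span n m edge H a Ha; apply.
pose I i (t : memory) := let X := flags n aReach t in
  [/\ r \in X, X \subset Z & X = Z \/ i < #|X|].
(* After [n] sweeps the second alternative would require more than [n] vertices. *)
suff [_ _ [//|]] : I (s 0 1) (run (forVertices cSweep sweep) s).
  by rewrite ltnNge ld -[X in _ <= X]card_ord max_card.
apply: (run_For I) => [//||i t lt_i ti agr].
  rewrite /I (flags_eq _ _ s) => [|j]; last by rewrite update_neq.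
  by rewrite s_r set11 sub1set Zr cards1; split=> //; right.
have ldt : loaded t by exact: loaded_agree agr ld.
rewrite /I [flags _ _ (update _ _ _ _)](flags_eq _ _ (run sweep t)); last first.
  by move=> j; rewrite update_neq.
have HE : flags m aActive t = H by apply: flags_eq => j; rewrite agr.
have := sweep_spec t Z ldt; rewrite HE => /(_ closedZ).
set X := flags n aReach t; set X' := flags n aReach _ => spec [Xr sXZ grown].
have [sXX' sX'Z closed'] := spec sXZ; split=> //; first exact: subsetP Xr.
have [eqX|neqX] := eqVneq X' X.
  left; apply/eqP; rewrite eqEsubset sX'Z /=; apply/subsetP => v; rewrite inE.
  by apply: closed_separates; rewrite eqX // in closed' *.
case: grown => [eqZ|lt_X]; first by left; apply/eqP; rewrite eqEsubset sX'Z -eqZ.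
right; apply: leq_trans (proper_card _); first exact: lt_X.
by rewrite properEneq eq_sym neqX.
Qed.

Lemma reach_spec s (e : 'I_m) : loaded s -> s cTree 0 = e -> edge e != set0 ->
  exists2 r, r \in edge e & flags n aReach (run reach s) =
    [set v | diff n r v \in span (flags m aActive s)].
Proof.
move=> ld se /set0Pn[u eu]; rewrite /reach !run_Then run_Assign.
set s1 := run clear s; have ld1 : loaded s1 by exact: loaded_run.
set s2 := run find_root s1; have ld2 : loaded s2 by exact: loaded_run.
have clear1 v : v < n -> s1 aReach v = 0.
  rewrite -ld => lt_v; rewrite /s1 (For_map aReach id (fun _ _ => 0)) //.
  by move=> i t j _ ti agr; rewrite run_Assign update_same /= ti.
have root : (word e (s2 vRoot 0) != 0) && (s2 vRoot 0 < n).
  have -> : s2 vRoot 0 = iteri n (fun i y => if word e i != 0 then i else y) (s1 vRoot 0).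
    rewrite -ld1 /s2 (For_fold _ _ (fun i y => if word e i != 0 then i else y)) //.
    move=> i t _ ti agr; have ldt : loaded t by exact: loaded_agree agr ld1.
    rewrite run_When run_Assign eval_field //= ti (agr cTree) // /s1 run_frame // se.
    by case: ifP => //; rewrite update_eq ti.
  apply: (iteri_last n (fun i => word e i != 0)); rewrite has_iota_ord.
  by apply/existsP; exists u; rewrite inE in eu.
have /andP[er lt_r] := root; exists (Ordinal lt_r); first by rewrite inE.
rewrite [eval _ _]/= [eval _ (Const 1)]/=; set s3 := update _ _ _ _.
have ld3 : loaded s3 by exact: loaded_update.
rewrite (sweeps_spec _ (Ordinal lt_r)) //.
  rewrite (flags_eq _ _ s) // => j.
  by rewrite /s3 update_neq // /s2 run_frame // /s1 run_frame.
apply/setP => v; rewrite !inE /s3 update_same -[v == _]/(v == s2 vRoot 0 :> nat).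
by case: ifP => // _; rewrite /s2 run_frame // clear1.
Qed.

Definition weighted (s : memory) : Prop := forall i, i < m -> s aWeight i = scaled i.

Lemma weighted_run p s : aWeight \notin writes p -> weighted s -> weighted (run p s).
Proof. by move=> w_p wt_s i lt_i; rewrite run_frame ?wt_s. Qed.

Lemma weighted_agree ws s t : aWeight \notin ws -> agree ws s t -> weighted s -> weighted t.
Proof. by move=> w_ws agr wt_s i lt_i; rewrite agr ?wt_s. Qed.

Lemma weighted_update s a i v : a != aWeight -> weighted s -> weighted (update s a i v).
Proof. by move=> a_w wt_s j lt_j; rewrite update_neq 1?eq_sym ?wt_s. Qed.

Lemma activate_spec s (e : 'I_m) : loaded s -> weighted s -> s cTree 0 = e ->
  flags m aActive (run activate s) = flags m aTrial s :|: before m wgt tree e.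
Proof.
move=> ld wt_s se; apply/setP => f; rewrite !inE /activate /forEdges.
pose P i := (word i (n + 2) != 0) && (scaled i * m + i < scaled e * m + e).
rewrite (For_map aActive id (fun i _ => if P i then 1 else s aTrial i)) ?ld //.
  by rewrite -/(P f); case: (P f); rewrite ?orbT ?orbF.
move=> i t j lt_i ti agr; have ldt : loaded t by exact: loaded_agree agr ld.
have wt_t : weighted t by exact: weighted_agree agr wt_s.
rewrite run_Then run_When !run_Assign [eval t (var _)]/= ti.
set t1 := update _ _ _ _.
have ld1 : loaded t1 by exact: loaded_update.
have wt1 : weighted t1 by exact: weighted_update.
have t1i : t1 cMark 0 = i by rewrite /t1 update_neq.
have t1e : t1 cTree 0 = e by rewrite /t1 update_neq // (agr cTree).
have -> : (eval t1 (Mul (in_tree cMark)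
    (Defs.Sub (key_expr cTree) (key_expr cMark))) != 0) = P i.
  rewrite -[eval t1 _]/(eval t1 (in_tree cMark) *
    (eval t1 (key_expr cTree) - eval t1 (key_expr cMark))).
  by rewrite eval_field // /= t1i t1e !ld1 !wt1 // muln_eq0 negb_or subn_eq0 -ltnNge.
case: (P i).
  rewrite update_same [eval t1 _]/= t1i; case: eqP => // neq.
  by rewrite /t1 update_same; case: eqP.
by rewrite /t1 update_same /= ti (agr aTrial).
Qed.

Lemma keep_if_cut_spec s (e : 'I_m) : loaded s -> s cTree 0 = e -> s aKruskal e = 0 ->
  (run keep_if_cut s aKruskal e != 0) = ~~ [forall v in edge e, v \in flags n aReach s].
Proof.
move=> ld se se0; pose P i := (word e i != 0) && (s aReach i == 0).
rewrite /keep_if_cut /forVertices (For_fold _ _ (fun i b => if P i then 1 else b)) //.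
  rewrite iteri_flag se0 ld has_iota_ord negb_forall_in.
  by apply: eq_existsb => v; rewrite !inE negbK.
move=> i t _ ti agr; have ldt : loaded t by exact: loaded_agree agr ld.
rewrite run_When run_Assign.
rewrite -[eval t (Mul _ _)]/(eval t (incidence cTree cVertex) *
  (1 - t aReach (t cVertex 0))).
rewrite eval_field // muln_eq0 negb_or subn_eq0 -ltnNge ltnS leqn0.
rewrite /= ti (agr cTree) // (agr aReach) // se -/(P i).
by case: (P i) => //; rewrite update_eq.
Qed.

Lemma keep_if_cut_other (s : memory) (e : 'I_m) (j : nat) : s cTree 0 = e -> j != e ->
  run keep_if_cut s aKruskal j = s aKruskal j.
Proof.
move=> se neq; rewrite /keep_if_cut /forVertices (For_fold _ _ (fun _ b => b)) //.
  by elim: (s 0 1) => //= k ->.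
move=> i t _ ti agr; rewrite run_When run_Assign; case: ifP => // _.
by rewrite update_same /= (agr cTree) // se (negPf neq).
Qed.

Hypothesis tree2 : {in tree, forall e, #|edge e| = 2}.

Local Notation kruskal_set := (kruskal n m edge wgt tree).
Local Notation mst_weight := (mst n m edge wgt tree).

Lemma kruskal_one_spec s (e : 'I_m) : loaded s -> weighted s -> s cTree 0 = e ->
  let K := kruskal_set (flags m aTrial s) in
  let t := run kruskal_one s in
  [/\ (t aKruskal e != 0) = (e \in K),
      forall j : nat, j != e -> t aKruskal j = s aKruskal j &
      t vMst 0 = s vMst 0 + if e \in K then wgt e else 0].
Proof.
move=> ld wt_s se K; rewrite /kruskal_one run_Then run_When run_Assign.
rewrite [eval s _]/= [eval s (Const 0)]/= se; set s1 := update _ _ _ _.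
have ld1 : loaded s1 by exact: loaded_update.
have wt1 : weighted s1 by exact: weighted_update.
have s1e : s1 cTree 0 = e by rewrite /s1 update_neq.
have trial1 : flags m aTrial s1 = flags m aTrial s.
  by apply: flags_eq => j; rewrite /s1 update_neq.
have other1 (j : nat) : j != e -> s1 aKruskal j = s aKruskal j.
  by move=> neq; rewrite /s1 update_same (negPf neq).
have -> : (eval s1 (in_tree cTree) != 0) = (e \in tree).
  by rewrite eval_field //= s1e ld1 inE.
case: (boolP (e \in tree)) => [Te|nTe] /=; last first.
  have -> : (e \in K) = false by rewrite inE (negPf nTe).
  by split=> //; rewrite /s1 ?update_eq // update_neq // addn0.
rewrite !run_Then run_When; set s2 := run activate s1.
have ld2 : loaded s2 by exact: loaded_run.
have s2e : s2 cTree 0 = e by rewrite /s2 run_frame.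
have e0 : edge e != set0 by rewrite -card_gt0 tree2.
have [r er reachE] := reach_spec s2 e ld2 s2e e0.
set s3 := run reach s2 in reachE *.
have ld3 : loaded s3 by exact: loaded_run.
have s3e : s3 cTree 0 = e by rewrite /s3 run_frame.
have s3K j : s3 aKruskal j = s1 aKruskal j by rewrite /s3 run_frame // /s2 run_frame.
have s3e0 : s3 aKruskal e = 0 by rewrite s3K /s1 update_eq.
set s4 := run keep_if_cut s3.
have s4e : s4 cTree 0 = e by rewrite /s4 run_frame.
(* A vertex of the hyperedge is missed by the search from its root exactly when the hyperedge's
   space is not inside the span of the active ones. *)
have keptE : (s4 aKruskal e != 0) = (e \in K).
  rewrite keep_if_cut_spec // reachE inE Te /= -trial1 -activate_spec // -/s2.
  rewrite (edge_space_root _ _ _ _ r) //; congr (~~ _).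
  by apply: eq_forallb => v; rewrite !inE.
rewrite [eval s4 _]/= s4e keptE.
have other4 (j : nat) : j != e -> s4 aKruskal j = s aKruskal j.
  by move=> neq; rewrite /s4 (keep_if_cut_other _ e) // s3K other1.
have mst4 : s4 vMst 0 = s vMst 0.
  by rewrite /s4 run_frame // /s3 run_frame // /s2 run_frame // /s1 update_neq.
have wt4 : s4 aWeight e = wgt e.
  by rewrite /s4 run_frame // /s3 run_frame // /s2 run_frame // wt1.
case: ifP keptE => Ke keptE; last by rewrite addn0; split.
rewrite run_Assign [eval s4 (Const 0)]/=; split.
- by rewrite update_neq // keptE.
- by move=> j neq; rewrite update_neq // other4.
- by rewrite update_eq /= s4e wt4 mst4.
Qed.

Lemma sum_ltnS k (P : pred 'I_k) (f : 'I_k -> nat) (a : 'I_k) :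
  \sum_(j | P j && (j < a.+1)) f j =
  \sum_(j | P j && (j < a)) f j + if P a then f a else 0.
Proof.
rewrite big_mkcond [X in _ = X + _]big_mkcond (bigD1 a) //= ltnSn andbT.
rewrite [X in _ = X + _](bigD1 a) //= ltnn andbF add0n addnC; congr (_ + _).
by apply: eq_bigr => j neq; rewrite ltnS leq_eqVlt (inj_eq val_inj) (negPf neq).
Qed.

Lemma kruskal_spec s : loaded s -> weighted s ->
  flags m aKruskal (run kruskal_prog s) = kruskal_set (flags m aTrial s) /\
  run kruskal_prog s vMst 0 = mst_weight (flags m aTrial s).
Proof.
move=> ld wt_s; set K := kruskal_set _.
rewrite /kruskal_prog run_Then run_Assign [eval _ _]/=; set s1 := update _ _ _ _.
have ld1 : loaded s1 by exact: loaded_update.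
have wt1 : weighted s1 by exact: weighted_update.
pose I i (t : memory) := (forall j : 'I_m, j < i -> (t aKruskal j != 0) = (j \in K)) /\
  t vMst 0 = \sum_(j | (j \in K) && (j < i)) wgt j.
suff [flagK sumK] : I (s1 0 2) (run (forEdges cTree kruskal_one) s1).
  split; first by apply/setP => j; rewrite inE flagK // ld1.
  by rewrite sumK ld1; apply: eq_bigl => j; rewrite ltn_ord andbT.
apply: (run_For I) => [//||i t lt_i ti agr [flagK sumK]].
  split=> //; rewrite update_neq // /s1 update_eq.
  by rewrite big_pred0 // => j; rewrite ltn0 andbF.
have lt_im : i < m by rewrite -ld1.
have ldt : loaded t by exact: loaded_agree agr ld1.
have wt_t : weighted t by exact: weighted_agree agr wt1.
have := kruskal_one_spec t (Ordinal lt_im) ldt wt_t ti.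
have -> : flags m aTrial t = flags m aTrial s.
  by apply: flags_eq => j; rewrite (agr aTrial) // /s1 update_neq.
rewrite -/K => -[keptE otherE mstE]; split=> [j lt_j|].
  rewrite update_neq //; have [->|neq] := eqVneq j (Ordinal lt_im) => //.
  have neq' : j != i :> nat by [].
  by rewrite otherE // flagK //; move: lt_j; rewrite ltnS leq_eqVlt (negPf neq').
by rewrite update_neq // mstE sumK (sum_ltnS _ (fun j => j \in K) _ (Ordinal lt_im)).
Qed.

Lemma copy_spec s : loaded s -> flags m aTrial (run copy s) = flags m aChosen s.
Proof.
move=> ld; apply/setP => i; rewrite !inE /copy /forEdges.
rewrite (For_map aTrial id (fun i _ => s aChosen i)) ?ld //.
by move=> {}i t j _ ti agr; rewrite run_Assign update_same /= ti (agr aChosen).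
Qed.

Local Notation drop_of := (drop n m edge wgt tree).

Lemma candidate_spec s (a : 'I_m) : loaded s -> weighted s -> s cCand 0 = a ->
  let C := flags m aChosen s in
  s vBase 0 = mst_weight C ->
  let t := run candidate s in
  let better := s vBestDrop 0 * wgt a < drop_of C a * s vBestWeight 0 in
  [/\ t vBestDrop 0 = if better then drop_of C a else s vBestDrop 0,
      t vBestWeight 0 = if better then wgt a else s vBestWeight 0 &
      t vBest 0 = if better then nat_of_ord a else s vBest 0].
Proof.
move=> ld wt_s sa C base; cbv zeta; rewrite /candidate 3!run_Then run_When run_Assign.
set s1 := run copy s; have ld1 : loaded s1 by exact: loaded_run.
have s1a : eval s1 (var cCand) = a by rewrite /= /s1 run_frame.
rewrite s1a [eval s1 (Const 1)]/=; set s2 := update _ _ _ _.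
have ld2 : loaded s2 by exact: loaded_update.
have wt2 : weighted s2 by apply: weighted_update => //; exact: weighted_run.
have trial2 : flags m aTrial s2 = a |: C.
  rewrite /C -copy_spec //; apply/setP => j; rewrite !inE /s2 update_same.
  by rewrite (inj_eq val_inj); case: (j == a).
have [_ mst3] := kruskal_spec s2 ld2 wt2; rewrite trial2 in mst3.
set s3 := run kruskal_prog s2 in mst3 *.
have frame3 x : x \notin writes copy -> x != aTrial -> x \notin writes kruskal_prog ->
  forall j, s3 x j = s x j.
  by move=> x1 x2 x3 j; rewrite /s3 run_frame // /s2 update_neq // /s1 run_frame.
have dropE : s3 vBase 0 - s3 vMst 0 = drop_of C a.
  by rewrite (frame3 vBase) // base mst3.
have wt3 : s3 aWeight (s3 cCand 0) = wgt a.
  by rewrite (frame3 cCand) // sa (frame3 aWeight) // wt_s.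
have -> : (eval s3 (Defs.Sub (Mul (Defs.Sub (var vBase) (var vMst)) (var vBestWeight))
    (Mul (var vBestDrop) (at_ aWeight cCand))) != 0) =
    (s vBestDrop 0 * wgt a < drop_of C a * s vBestWeight 0).
  rewrite /= dropE wt3 (frame3 vBestWeight) // (frame3 vBestDrop) //.
  by rewrite subn_eq0 -ltnNge.
case: (_ < _); last by split; rewrite frame3.
rewrite !run_Then !run_Assign [eval s3 (Const 0)]/=; set u1 := update s3 _ _ _.
rewrite [eval u1 (Const 0)]/=; set u2 := update u1 _ _ _.
rewrite [eval u2 (Const 0)]/=; split.
- by rewrite update_neq // /u2 update_neq // /u1 update_eq.
- by rewrite update_neq // /u2 update_eq /u1 /= !update_neq.
- by rewrite update_eq /u2 /u1 /= !update_neq // (frame3 cCand).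
Qed.

Lemma round_spec s : loaded s -> weighted s ->
  greedy_step n m edge wgt tree (flags m aChosen s) (flags m aChosen (run round s)).
Proof.
move=> ld wt_s; set C := flags m aChosen s; rewrite /round 7!run_Then !run_Assign.
set s1 := run copy s.
have ld1 : loaded s1 by exact: loaded_run.
have wt1 : weighted s1 by exact: weighted_run.
have [_ mst2] := kruskal_spec s1 ld1 wt1; rewrite copy_spec // -/C in mst2.
set s2 := run kruskal_prog s1 in mst2 *.
have ld2 : loaded s2 by exact: loaded_run.
rewrite [eval s2 (Const 0)]/= [eval s2 _]/=; set s3 := update s2 _ _ _.
rewrite [eval s3 (Const 0)]/= [eval s3 _]/=; set s4 := update s3 _ _ _.
rewrite [eval s4 (Const 0)]/= [eval s4 _]/=; set s5 := update s4 _ _ _.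
rewrite [eval s5 (Const 0)]/=; set s6 := update s5 _ _ _.
have ld5 : loaded s5 by do 3!apply: loaded_update => //.
have ld6 : loaded s6 by apply: loaded_update.
have wt6 : weighted s6 by do 4!apply: weighted_update => //; exact: weighted_run.
have chosen6 : flags m aChosen s6 = C.
  apply: flags_eq => j; rewrite /s6 update_neq // /s5 update_neq // /s4 update_neq //.
  by rewrite /s3 update_neq // /s2 run_frame // /s1 run_frame.
have base6 : s6 vBase 0 = mst_weight C.
  by rewrite /s6 update_neq // /s5 update_neq // /s4 update_neq // /s3 update_eq.
(* [bd / bw] is the best ratio so far. The condition [bw <= bd] makes every later winner have weight
   below its drop, and [0 < bd] allows cancelling [bd] when chaining two comparisons. *)
pose I i (t : memory) := let bd := t vBestDrop 0 in let bw := t vBestWeight 0 in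
  [/\ 0 < bd, bw <= bd,
      forall b : 'I_m, b < i -> drop_of C b * bw <= bd * wgt b &
      [/\ bd = 1, bw = 1 & t vBest 0 = m] \/
      exists a : 'I_m, [/\ t vBest 0 = a, bd = drop_of C a, bw = wgt a & bw < bd]].
have : I (s6 0 2) (run (forEdges cCand candidate) s6).
  apply: (run_For I) => [//||i t lt_i ti agr].
    rewrite /I !(update_neq _ cCand) //.
    have -> : s6 vBestDrop 0 = 1.
      by rewrite /s6 update_neq // /s5 update_neq // /s4 update_eq.
    have -> : s6 vBestWeight 0 = 1 by rewrite /s6 update_neq // /s5 update_eq.
    by split=> //; left; rewrite /s6 update_eq /= ld5.
  have lt_im : i < m by rewrite -ld6.
  have ldt : loaded t by exact: loaded_agree agr ld6.
  have wt_t : weighted t by exact: weighted_agree agr wt6.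
  have chosen_t : flags m aChosen t = C.
    by rewrite -chosen6; apply: flags_eq => j; rewrite (agr aChosen).
  have := candidate_spec t (Ordinal lt_im) ldt wt_t ti.
  rewrite chosen_t (agr vBase) // => /(_ base6) /=.
  rewrite /I !(update_neq _ cCand) // => -[-> -> ->].
  set bd := t vBestDrop 0; set bw := t vBestWeight 0; set d := drop_of C _.
  set w := wgt _ => -[bd0 le_bw best pick].
  have split_i (b : 'I_m) : b < i.+1 -> b = Ordinal lt_im \/ b < i.
    by rewrite ltnS leq_eqVlt => /predU1P[eq_b|]; [left; apply: val_inj|right].
  case: (ltnP (bd * w)) => cmp.
    have lt_w : w < d.
      rewrite ltnNge; apply/negP => le_dw.
      by have := leq_mul le_bw le_dw; move: cmp; lia.
    split; [exact: leq_ltn_trans lt_w|exact: ltnW| |].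
      move=> b /split_i[->|/best best_b]; first by rewrite mulnC.
      (* d_b w bd <= d_b d bw <= d bd w_b *)
      rewrite -(leq_pmul2l bd0).
      have := leq_mul (leqnn (drop_of C b)) (ltnW cmp).
      have := leq_mul (leqnn d) best_b.
      by lia.
    by right; exists (Ordinal lt_im).
  split=> // b /split_i[->|/best]//.
set s7 := run _ s6; rewrite ld6 => -[bd0 _ best pick].
rewrite [eval s7 _]/= [eval s7 (Const 1)]/=.
have chosen7 : flags m aChosen s7 = C.
  by rewrite -chosen6; apply: flags_eq => j; rewrite /s7 run_frame.
case: pick => [[bd1 bw1 ->]|[a [-> bdE bwE lt_bw]]].
  (* With [bd = bw = 1] the maximality of the ratio reads as [stuck]. *)
  left; split.
    rewrite -chosen7; apply/setP => j; rewrite !inE update_same.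
    by rewrite (ltn_eqF (ltn_ord j)).
  by move=> b; have := best b (ltn_ord b); rewrite bd1 bw1 muln1 mul1n.
right; exists a; split.
- rewrite -chosen7; apply/setP => j; rewrite !inE update_same (inj_eq val_inj).
  by case: (j == a).
- by rewrite -bdE -bwE.
- by move=> b; rewrite -bdE -bwE best.
Qed.

(** One [C] serves for every [B]: the program does not know the optimum with which it is
    compared. *)
Lemma main_spec (R : realType) (s : memory) : loaded s ->
  (forall a j, a != 0 -> s a j = 0) -> spanning n m edge tree ->
  exists C : {set 'I_m},
    (forall B, spanning n m edge B -> greedy_invariant R n m edge wgt tree B m C) /\
    output (run main s) =
      mkseq (fun i => has (fun j : 'I_m => i == j) (enum (C :|: kruskal_set C)) : nat) m.
Proof.
move=> ld s0 spanT; rewrite /main 4!run_Then.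
set s1 := run scale s.
have ld1 : loaded s1 by exact: loaded_run.
have wt1 : weighted s1 by exact: scale_spec.
set s2 := run (forEdges cRound round) s1.
have ld2 : loaded s2 by exact: loaded_run.
have wt2 : weighted s2 by exact: weighted_run.
exists (flags m aChosen s2); split.
  move=> B spanB.
  pose I i (t : memory) := greedy_invariant R n m edge wgt tree B i (flags m aChosen t).
  suff : I (s1 0 2) s2 by rewrite ld1.
  apply: (run_For I) => [//||i t lt_i ti agr It].
    rewrite /I (_ : flags _ _ _ = set0); first exact: greedy_invariant0.
    by apply/setP => j; rewrite !inE update_neq // /s1 run_frame // s0.
  have ldt : loaded t by exact: loaded_agree agr ld1.
  have wt_t : weighted t by exact: weighted_agree agr wt1.
  rewrite /I (flags_eq _ _ (run round t)); last by move=> j; rewrite update_neq.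
  exact: greedy_invariant_step (round_spec t ldt wt_t) It.
set C := flags m aChosen s2; set s3 := run copy s2.
have ld3 : loaded s3 by exact: loaded_run.
have wt3 : weighted s3 by exact: weighted_run.
have [K4 _] := kruskal_spec s3 ld3 wt3; rewrite copy_spec // -/C in K4.
set s4 := run kruskal_prog s3 in K4 *.
have ld4 : loaded s4 by exact: loaded_run.
have C4 j : s4 aChosen j = s2 aChosen j by rewrite /s4 run_frame // /s3 run_frame.
rewrite /report run_Then run_Assign [eval _ (Const 0)]/=.
set s5 := run _ s4; have ld5 : loaded s5 by exact: loaded_run.
rewrite /output -[1]/aOut update_eq [eval _ _]/= ld5.
apply/eq_in_map => i; rewrite mem_iota add0n => /andP[_ lt_i].
rewrite update_same /= /s5.
rewrite (For_map aOut succn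
  (fun j x => if s4 aChosen j + s4 aKruskal j != 0 then 1 else x)) ?ld4 //; last 2 first.
- exact: succn_inj.
- move=> k t j lt_k tk agr; rewrite run_When run_Assign /= tk addn1.
  rewrite (agr aChosen) // (agr aKruskal) //.
  by case: (_ != 0); [rewrite update_same|case: ifP].
have -> : has (fun j : 'I_m => i == j) (enum (C :|: kruskal_set C)) =
    (s4 aChosen i + s4 aKruskal i != 0).
  have memE (j : 'I_m) : (j \in C :|: kruskal_set C) = (s4 aChosen j + s4 aKruskal j != 0).
    by rewrite -K4 !inE C4 addn_eq0 negb_and.
  apply/hasP/idP => [[j]|nz]; first by rewrite mem_enum memE => nz /eqP->.
  by exists (Ordinal lt_i); rewrite ?mem_enum ?memE.
case: (_ != 0) => //; rewrite /s4 run_frame // /s3 run_frame // /s2 run_frame //.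
by rewrite /s1 run_frame // s0.
Qed.

End Correctness.

(** * Decoding the input *)

Lemma nth_flatten_block (T : Type) (x0 : T) (k : nat) (ss : seq (seq T)) i j :
  all (fun s => size s == k) ss -> i < size ss -> j < k ->
  nth x0 (flatten ss) (i * k + j) = nth x0 (nth [::] ss i) j.
Proof.
elim: ss i => //= s ss IH [|i] /andP[/eqP sz all_k] lt_i lt_j.
  by rewrite mul0n add0n nth_cat sz lt_j.
by rewrite nth_cat sz mulSn -addnA ltnNge leq_addr /= addKn IH.
Qed.

Section Decoding.

Variables (n : nat) (c : {set 'I_n} -> rat) (F : {set {set 'I_n}}).
Variable es : seq {set 'I_n}.

Definition input_word : nat -> nat :=
  input_memory (encode_instance es c F) 0.

Lemma size_encode_hyperedge A : size (encode_hyperedge c F A) = n + 3.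
Proof. by rewrite size_cat size_map size_enum_ord. Qed.

Lemma word_input i j : i < size es -> j < n + 3 ->
  word input_word i j = nth 0 (encode_hyperedge c F (nth set0 es i)) j.
Proof.
move=> lt_i lt_j.
have -> : word input_word i j =
    nth 0 (flatten [seq encode_hyperedge c F A | A <- es]) (i * (n + 3) + j) by [].
rewrite nth_flatten_block ?size_map ?(nth_map set0) //.
by apply/allP => _ /mapP[A _ ->]; rewrite size_encode_hyperedge.
Qed.

Lemma nth_encode_vertex A (v : 'I_n) : nth 0 (encode_hyperedge c F A) v = (v \in A).
Proof.
rewrite nth_cat size_map size_enum_ord ltn_ord (nth_map v) ?size_enum_ord //.
by rewrite nth_ord_enum.
Qed.

Lemma nth_encode_tail A k : nth 0 (encode_hyperedge c F A) (n + k) =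
  nth 0 [:: `|numq (c A)|%N; `|denq (c A)|%N; nat_of_bool (A \in F)] k.
Proof. by rewrite nth_cat size_map size_enum_ord ltnNge leq_addr /= addKn. Qed.

Lemma edge_input (i : 'I_(size es)) : edge input_word i = nth set0 es i :> {set 'I_n}.
Proof.
apply/setP => v; rewrite inE word_input ?nth_encode_vertex ?lt0b ?eqb0 ?negbK //.
exact: ltn_addr.
Qed.

Lemma tree_input (i : 'I_(size es)) : (i \in tree input_word) = (nth set0 es i \in F).
Proof.
rewrite inE word_input ?ltn_add2l // nth_encode_tail /=.
by rewrite eqb0 negbK.
Qed.

(** The common factor that turns all costs into natural numbers; it cancels from the final bound. *)
Definition den_prod : nat := \prod_(j < size es) `|denq (c (nth set0 es j))|%N.

Lemma den_prod_gt0 : 0 < den_prod.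
Proof. by rewrite prodn_gt0 // => j; rewrite absz_gt0 denq_eq0. Qed.

Lemma wgt_input (i : 'I_(size es)) : (0 <= c (nth set0 es i))%R ->
  ((wgt input_word i)%:R = c (nth set0 es i) * den_prod%:R)%R.
Proof.
move=> c0; rewrite /wgt /scaled.
have -> : word input_word i (input_word 1) = `|numq (c (nth set0 es i))|%N.
  rewrite word_input //; last by rewrite -[input_word 1]/n; lia.
  by have := nth_encode_tail (nth set0 es i) 0; rewrite addn0.
rewrite -[input_word 2]/(size es) big_mkord.
rewrite (eq_bigr (fun j : 'I_(size es) => `|denq (c (nth set0 es j))|%N)); last first.
  move=> j _; rewrite -[input_word 1]/n word_input ?ltn_add2l //.
  by rewrite nth_encode_tail.
have -> : den_prod = `|denq (c (nth set0 es i))|%N *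
    \prod_(j < size es | j != i :> nat) `|denq (c (nth set0 es j))|%N.
  by rewrite /den_prod (bigD1 i).
rewrite !natrM mulrA; congr (_ * _)%R.
rewrite !natr_absz normr_denq ger0_norm ?numq_ge0 //.
by rewrite -[X in (X * _)%R]divq_num_den divfK // intr_eq0 denq_eq0.
Qed.

(** The word [n] alone contributes only its bit length, but each hyperedge carries an incidence
    vector of [n] words. Without hyperedges the hypothesis leaves [n <= 1]. *)
Lemma encode_instance_bounds : (1 < n -> es != [::]) ->
  n <= word_size (encode_instance es c F) /\
  size es <= word_size (encode_instance es c F).
Proof.
move=> nonempty.
have size_W : size (encode_instance es c F) <= word_size (encode_instance es c F).
  by rewrite -sum1_size leq_sum.
have sizeE : size (encode_instance es c F) = 2 + size es * (n + 3).
  rewrite /encode_instance /= -[2 + _]/(_.+2); congr _.+2; elim: (es) => //= A es' IH.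
  by rewrite size_cat IH mulSn size_encode_hyperedge.
by case: es nonempty size_W sizeE => [|A es']; rewrite /= ; nia.
Qed.

End Decoding.

(** * The guarantee on encoded instances *)

Lemma connected_spanning_nonempty n (F : {set {set 'I_n}}) :
  1 < n -> connected_spanning F -> F != set0.
Proof.
case: n F => [|[|n]] // F _ /forallP/(_ ord0)/forallP/(_ ord_max)/connectP[[|v p]] //=.
by case/andP=> /exists_inP[X FX _] _ _; apply/set0Pn; exists X.
Qed.

Local Open Scope ring_scope.

Theorem theorem3 (R : realType) :
  exists (p : command) (q : {poly nat}),
  forall (n : nat) (E : {set {set 'I_n}}) (c : {set 'I_n} -> rat)
         (Tstar : {set {set 'I_n}}) (es : seq {set 'I_n}),
    {in E, forall A : {set 'I_n}, 0 <= c A} ->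
    spanning_tree2 E Tstar ->
    uniq es -> es =i E ->
    let w := encode_instance es c Tstar in
    let tau := min_cost E c in
    exists F : {set {set 'I_n}},
      [/\ computes_within p w q.[word_size w] (encode_subset es F),
          F \subset E,
          connected_spanning F &
          ratr (cost c F)
            <= ratr tau * (1 + ln (ratr (cost c Tstar) / ratr tau)) :> R].
Proof.
have [q comp] := computes_poly main wf_main.
exists (compile main), q => n E c Tstar es c0 [sTE T2 connT _] uniq_es es_E w tau.
pose inp := input_word n c Tstar es.
pose A (i : 'I_(size es)) : {set 'I_n} := nth set0 es i.
have AE i : edge inp i = A i by exact: edge_input.
have TE i : (i \in tree inp) = (A i \in Tstar) by exact: tree_input.
have A_E (i : 'I_(size es)) : A i \in E by rewrite -es_E mem_nth.
have A_inj : injective A.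
  by move=> i j /eqP; rewrite nth_uniq // => /eqP/val_inj.
(* As [es] lists [E] without repetition, sub-hypergraphs of [E] correspond to sets of indices. *)
have imA (B : {set {set 'I_n}}) : B \subset E ->
    edge inp @: [set i : 'I_(size es) | A i \in B] = B.
  move=> /subsetP sB; apply/setP => X; apply/imsetP/idP => [[i iB ->]|BX].
    by rewrite AE; rewrite inE in iB.
  have Xes : X \in es by rewrite es_E sB.
  have lt_X : (index X es < size es)%N by rewrite index_mem.
  have AX : A (Ordinal lt_X) = X by rewrite /A nth_index.
  by exists (Ordinal lt_X); rewrite ?inE ?AE AX.
have edge_inj : injective (edge inp) by move=> i j; rewrite !AE => /A_inj.
have costE (X : {set 'I_(size es)}) :
    cost c (edge inp @: X) * (den_prod n c es)%:R = (weight (size es) (wgt inp) X)%:R.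
  rewrite /cost big_imset /=; last by move=> i j _ _; apply: edge_inj.
  rewrite mulr_suml natr_sum; apply: eq_bigr => i _.
  by rewrite AE (wgt_input _ _ _ _ i) //; exact: c0 (A_E i).
have tree2 : {in tree inp, forall e, #|edge inp e| = 2%N}.
  by move=> e; rewrite TE => /T2; rewrite AE.
have treeE : edge inp @: tree inp = Tstar.
  rewrite (_ : tree inp = [set i : 'I_(size es) | A i \in Tstar]) ?imA //.
  by apply/setP => i; rewrite TE inE.
have spanT : spanning n (size es) (edge inp) (tree inp).
  by apply/connected_spanningP; rewrite treeE.
have EE : edge inp @: [set: 'I_(size es)] = E.
  rewrite (_ : setT = [set i : 'I_(size es) | A i \in E]) ?imA //.
  by apply/setP => i; rewrite !inE A_E.
have connE : connected_spanning E.
  rewrite -EE; apply/connected_spanningP => u v.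
  by apply: subvP (spanT u v); apply/edges_spanS/subsetT.
(* [E] is connected spanning because it contains [Tstar], so the minimum is attained, and comparison
   with [Tstar] bounds it. *)
have [B [sBE connB minB tauE]] : exists B : {set {set 'I_n}}, [/\ B \subset E, connected_spanning B,
    cost c B <= cost c Tstar & tau = cost c B].
  rewrite /tau /min_cost; case: arg_minP => [|B /andP[sBE connB] minB].
    by rewrite subxx.
  by exists B; split=> //; apply: minB; rewrite sTE.
pose J := [set i : 'I_(size es) | A i \in B].
have JE : edge inp @: J = B by exact: imA.
have spanJ : spanning n (size es) (edge inp) J by apply/connected_spanningP; rewrite JE.
have D0 : 0 < (den_prod n c es)%:R :> rat by rewrite ltr0n den_prod_gt0.
have le_JT : (weight (size es) (wgt inp) J <= weight (size es) (wgt inp) (tree inp))%N.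
  by rewrite -(ler_nat rat) -!costE JE treeE ler_pM2r.
have loop_counts : (n <= word_size w)%N /\ (size es <= word_size w)%N.
  apply: encode_instance_bounds => n_gt1.
  have /set0Pn[X TX] := connected_spanning_nonempty n Tstar n_gt1 connT.
  by have := subsetP sTE X TX; rewrite -es_E; case: (es).
have ld : loaded inp (input_memory w) by [].
have zero a j : a != 0%N -> input_memory w a j = 0%N by rewrite /input_memory => /negPf->.
have [C [inv outE]] := main_spec inp tree2 R _ ld zero spanT.
set K := C :|: _ in outE.
exists (edge inp @: K); split.
- have <- : output (run main (input_memory w)) = encode_subset es (edge inp @: K).
    rewrite outE; apply: (@eq_from_nth _ 0%N); rewrite size_mkseq ?size_map // => i lt_i.
    rewrite nth_mkseq // (nth_map set0) //; congr nat_of_bool.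
    rewrite -[nth set0 es i]/(A (Ordinal (lt_i : (i < size es)%N))) -AE.
    rewrite (mem_imset _ _ edge_inj); apply/hasP/idP => [[j]|Ki].
      by rewrite mem_enum => Kj /eqP eq_i; rewrite (_ : Ordinal _ = j) //; apply: val_inj.
    by eexists; [rewrite mem_enum; exact: Ki|].
  by case: loop_counts => le_n le_m; apply: comp.
- by rewrite -EE imsetS ?subsetT.
- by apply/connected_spanningP; apply: kruskal_spanning.
have bound := greedy_invariant_end R n _ _ _ _ tree2 spanT J spanJ C le_JT (inv J spanJ).
have ratrE (X : {set 'I_(size es)}) : ratr (cost c (edge inp @: X)) =
    (weight (size es) (wgt inp) X)%:R / (den_prod n c es)%:R :> R.
  rewrite -(ratr_nat R (weight _ _ _)) -costE rmorphM /= ratr_nat mulfK //.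
  by rewrite pnatr_eq0 -lt0n den_prod_gt0.
have DR : (den_prod n c es)%:R != 0 :> R by rewrite pnatr_eq0 -lt0n den_prod_gt0.
(* The common factor cancels inside the logarithm and scales both sides equally outside it. *)
rewrite tauE -JE -treeE !ratrE invf_div mulrA divfK // mulrAC.
by rewrite ler_pM2r // invr_gt0 ltr0n den_prod_gt0.
Qed.
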